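(* Let $\mathbf{h}=(h_0,\dots,h_d)\in\mathbb{N}^{d+1}$ with $h_0=1$ and $h_d=0$, and let $\partial h_j=\sum_{i=0}^j(h_i-h_{d-i})$. (a) If $\partial h_j>0$ for $0\le j\le\lfloor(d-1)/2\rfloor$, then there exists a simplicial poset $P$ such that $|\Gamma(P)|$ is a $(d-1)$-ball and $h(P)=\mathbf{h}$. (b) Alternatively, suppose $\partial h_j\ge 0$ for all $0\le j\le\lfloor(d-1)/2\rfloor$ and let $n$ with $0<n\le\lfloor(d-1)/2\rfloor$ be the smallest number such that $\partial h_n=0$. If $\sum_{i=0}^d h_i$ is even and $\partial h_l\le\sum_{i=0}^{n-1}h_{l-i}$ for $n+1\le l\le d-(n+1)$, then there exists a simplicial poset $P$ such that $|\Gamma(P)|$ is a $(d-1)$-ball and $h(P)=\mathbf{h}$.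
   Context: A simplicial poset is a finite poset $P$ with a minimum element $\hat 0$ such that for every $p\in P$ the closed interval $[\hat 0,p]$ is a Boolean algebra. There is a regular CW-complex $\Gamma(P)$ whose face poset is $P$ ($\hat 0$ corresponding to the empty face). Its closed faces are simplices, but distinct faces may have the same vertex set. An element $p$ with $[\hat0,p]$ Boolean of rank $i+1$ is an $i$-dimensional face. $f_i(P)$ is the number of $i$-dimensional faces ($f_{-1}=1$), and $P$ has dimension $d-1$ if $d-1$ is the largest $i$ with $f_i\neq 0$. For a $(d-1)$-dimensional simplicial poset the $h$-vector $h(P)=(h_0,\dots,h_d)$ is defined by $\sum_{i=0}^d h_ix^i=\sum_{i=0}^d f_{i-1}x^i(1-x)^{d-i}$. $|\Gamma(P)|$ denotes the geometric realization. *)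

(* Defs.v *)
From HB Require Import structures.
From mathcomp Require Import all_boot all_order all_algebra.
From mathcomp Require Import all_classical all_reals all_analysis.
From mathcomp Require Import Rstruct Rstruct_topology.
From Stdlib Require Import Rdefinitions.

Set Implicit Arguments.
Unset Strict Implicit.
Unset Printing Implicit Defensive.

Import Order.TTheory GRing.Theory Num.Theory.
Import numFieldNormedType.Exports.
Local Open Scope ring_scope.
Local Open Scope classical_set_scope.

Definition is_boolean_rank (T : finType) (le : rel T) (p : T) (n : nat) : bool :=
  [exists f : {ffun {set 'I_n} -> T},
     [forall A : {set 'I_n}, le (f A) p]
  && [forall q, le q p ==> [exists A : {set 'I_n}, f A == q]]
  && [forall A : {set 'I_n}, [forall B : {set 'I_n}, (A \subset B) == le (f A) (f B)]]].

Definition simplicial_poset (T : finType) (le : rel T) (z : T) : Prop :=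
  [/\ reflexive le, antisymmetric le, transitive le,
      (forall p, le z p) &
      (forall p, exists n, is_boolean_rank le p n)].

(* fcount le k = number of elements p with [0,p] Boolean of rank k,
   i.e. f_{k-1}(P) (so fcount le 0 = f_{-1} = 1). *)
Definition fcount (T : finType) (le : rel T) (k : nat) : nat :=
  #|[set p : T | is_boolean_rank le p k]|.

Definition has_dim_dm1 (T : finType) (le : rel T) (d : nat) : Prop :=
  fcount le d <> 0%N /\ (forall k : nat, leq d.+1 k -> fcount le k = 0%N).

Definition hpoly (T : finType) (le : rel T) (d : nat) : {poly int} :=
  \sum_(i < d.+1) ((fcount le i)%:R * 'X^i * (1 - 'X) ^+ (d - i)).

Definition hvec_eq (T : finType) (le : rel T) (d : nat) (h : seq nat) : Prop :=
  has_dim_dm1 le d /\ forall i : nat, leq i d -> (hpoly le d)`_i = (nth 0%N h i)%:Z.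

Definition coord (T : finType) (x : 'rV[R]_#|T|) (p : T) : R := x ord0 (enum_rank p).

(* |Gamma(P)| is realized as the order complex of P \ {0}: points are convex
   combinations of the elements of P \ {0} whose support is a chain. *)
Definition realization (T : finType) (le : rel T) (z : T) : set 'rV[R]_#|T| :=
  [set x | (forall p, 0 <= coord x p) /\ \sum_(p : T) coord x p = 1 /\
           coord x z = 0 /\
           (forall p q, 0 < coord x p -> 0 < coord x q -> le p q || le q p)].

Definition is_ball (m k : nat) (A : set 'rV[R]_m) : Prop :=
  exists (f : 'rV[R]_m -> 'rV[R]_k) (g : 'rV[R]_k -> 'rV[R]_m),
    (forall x, A x -> closed_ball (0 : 'rV[R]_k) 1 (f x)) /\
    (forall y, closed_ball (0 : 'rV[R]_k) 1 y -> A (g y)) /\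
    (forall x, A x -> g (f x) = x) /\
    (forall y, closed_ball (0 : 'rV[R]_k) 1 y -> f (g y) = y) /\
    {within A, continuous f} /\
    {within closed_ball (0 : 'rV[R]_k) 1, continuous g}.

Definition realizable_ball (d : nat) (h : seq nat) : Prop :=
  exists (T : finType) (le : rel T) (z : T),
    [/\ simplicial_poset le z, is_ball (d.-1) (realization le z) & hvec_eq le d h].

Definition dh (d : nat) (h : seq nat) (j : nat) : int :=
  \sum_(0 <= i < j.+1) ((nth 0%N h i)%:Z - (nth 0%N h (d - i))%:Z).

(* Main.v *)
Require Import Defs.
From HB Require Import structures.
From mathcomp Require Import all_boot all_order all_algebra.
From mathcomp Require Import zify lra ring.

(** A simplicial poset is glued from copies of one simplex on the vertex set ['I_d], always
identifying faces with equal vertex sets. The k-th copy is attached along the facets opposite to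
the vertices of a set [C k], so it contributes exactly the faces containing [C k] and the
h-polynomial is the sum of the ['X^#|C k|].

Attaching a simplex to a ball in this way gives a ball: parametrize the old ball by the unit ball,
push the attaching region inwards along the rays from the centre, and let the new simplex fill the
lens thus freed.

It remains to choose the sets. Sort the prescribed sizes and match the i-th smallest with the i-th
largest; the hypotheses on [dh] say that each pair has sum at most [d] and, in case (b), at least
[d - n]. Running through the pairs from the middle outwards, every simplex can be attached to the
preceding one, because consecutive sets can be chosen disjoint. In case (b) the facets opposite to
the first [d - n] vertices that remain free at the end form the star of the complementary face, and
a last simplex of size [d - n] is attached along them. *)

Set Implicit Arguments.
Unset Strict Implicit.
Unset Printing Implicit Defensive.
Import Order.TTheory GRing.Theory Num.Theory.

(** * Shellings *)

(** The first simplex, with [C 0] empty, accounts for the entry 1 of [h] at 0. In case (a) the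
    strict positivity of [dh] is the slack that pays for it: without this unit, at least as many
    sizes are [<= l] as are [>= d - l]. In case (b) the slack is gone at [l = n]. One size [d - n]
    is therefore set aside for the last simplex (minimality of [n] guarantees that it occurs), and
    all the others must pair off, which is where parity enters. The two sets of a pair are adjacent
    segments starting at 0, so a pair sum of at least [d - n] means that they cover the first
    [d - n] vertices. Each of these vertices then lies in exactly one set of every pair, and this
    leaves exactly one free facet opposite to it. For the topology, the induction carries explicit
    maps onto the unit ball instead of citing that balls glued along balls are balls. The delicate
    point is continuity: the height of the lens must vanish along the rim of the attaching region,
    so no free facet outside the region may contain a face interior to it. This is why the notion of
    shelling used here includes [shelling_frontier]. *)

Section Shelling.
Variable d : nat.
Variables (C : nat -> {set 'I_d}) (p : nat -> 'I_d -> nat)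
  (rep : nat -> {set 'I_d} -> nat).

(* [p k v] is the earlier simplex to which the facet of simplex [k] opposite to [v] is glued, and
   [rep k S] is the first simplex containing the face of simplex [k] with vertex set [S]; a facet
   is free at stage [N] if it lies in only one of the first [N] simplices. *)
Definition free_facet (N l : nat) (u : 'I_d) : Prop :=
  [/\ (l < N)%N, u \notin C l & forall j, (j < N)%N -> u \in C j -> p j u <> l].

(** A face of simplex [k] that contains [~: C k] but misses a vertex of [C k] is interior to the
    attaching region; [shelling_frontier] says that only glued facets pass through it. Compatibility
    of the gluings is hidden in [shelling_old]: the parents for [v] and [w] agree on every face
    missing both. *)
Record shelling (M : nat) : Prop := Shelling {
  shelling_neq0 : forall k, (0 < k < M)%N -> C k != finset.set0;
  shelling_neqT : forall k, (k < M)%N -> C k != [set: 'I_d]%SET;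
  shelling_new : forall k (S : {set 'I_d}), (k < M)%N -> C k \subset S -> rep k S = k;
  shelling_old : forall k v (S : {set 'I_d}), (k < M)%N -> v \in C k -> v \notin S ->
    rep k S = rep (p k v) S;
  shelling_free : forall k v, (k < M)%N -> v \in C k -> free_facet k (p k v) v;
  shelling_frontier : forall k l u (S : {set 'I_d}), (k < M)%N -> free_facet k l u ->
    u \in C k -> u \notin S -> ~: C k \subset S -> rep l S = rep k S ->
    l = p k u }.

Variable M : nat.
Hypothesis sh : shelling M.

Lemma shelling_C0 : (0 < M)%N -> C 0 = finset.set0.
Proof.
move=> M0; apply/eqP/negPn/negP => /set0Pn[v vC].
by have [] := shelling_free sh M0 vC.
Qed.

Lemma parent_lt k v : (k < M)%N -> v \in C k -> (p k v < k)%N.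
Proof. by move=> kM vC; have [] := shelling_free sh kM vC. Qed.

Lemma rep_le k S : (k < M)%N -> (rep k S <= k)%N.
Proof.
elim/ltn_ind: k => k IH kM.
have [CS|/subsetPn[v vC vS]] := boolP (C k \subset S); first by rewrite (shelling_new sh).
rewrite (shelling_old sh kM vC vS); have pk := parent_lt kM vC.
by apply: leq_trans (IH _ pk (ltn_trans pk kM)) (ltnW pk).
Qed.

Lemma rep_subset k S : (k < M)%N -> C (rep k S) \subset S.
Proof.
elim/ltn_ind: k => k IH kM.
have [CS|/subsetPn[v vC vS]] := boolP (C k \subset S); first by rewrite (shelling_new sh).
rewrite (shelling_old sh kM vC vS); have pk := parent_lt kM vC.
exact: IH pk (ltn_trans pk kM).
Qed.

(** A vertex of [C k] missing from [S'] is missing from [S], so both descents can follow the same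
    parent. Transitivity of the face order rests on this. *)
Lemma rep_trans k (S S' : {set 'I_d}) : (k < M)%N -> S \subset S' -> rep (rep k S') S = rep k S.
Proof.
move=> + SS'; elim/ltn_ind: k => k IH kM.
have [CS|/subsetPn[v vC vS]] := boolP (C k \subset S').
  by rewrite (shelling_new sh kM CS).
have vS2 : v \notin S by apply: contra vS; exact: (fintype.subsetP SS').
rewrite (shelling_old sh kM vC vS) (shelling_old sh kM vC vS2).
have pk := parent_lt kM vC; exact: IH pk (ltn_trans pk kM).
Qed.

Lemma free_facetS N l u : (N < M)%N ->
  free_facet N.+1 l u <->
  (l = N /\ u \notin C N) \/ (free_facet N l u /\ ~ (u \in C N /\ p N u = l)).
Proof.
move=> NM; split.
  move=> [lN uC h]; move: lN; rewrite ltnS leq_eqVlt => /predU1P[lN|lN].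
    by left; split=> //; rewrite -lN.
  right; split; first by split => // j jN; apply: h; rewrite ltnS ltnW.
  by move=> [uCN]; exact: h.
move=> [[-> uC]|[[lN uC h] nl]].
  split => // j; rewrite ltnS => jN uCj E.
  by have := parent_lt (leq_ltn_trans jN NM) uCj; rewrite E ltnNge jN.
split => [||j]; [exact: ltnW| by []|].
by rewrite ltnS leq_eqVlt => /predU1P[-> uCj E|]; [apply: nl|exact: h].
Qed.

End Shelling.

(** * Chains in which every simplex is attached to the preceding one *)

Section ChainShelling.
Variables (d : nat) (C : nat -> {set 'I_d}).

(** When [C 0] is empty this is the largest [i <= k] with [C i \subset S]: the face is traced back
    until it is new. *)
Fixpoint chain_rep (k : nat) (S : {set 'I_d}) : nat :=
  if k is k'.+1 then if C k \subset S then k else chain_rep k' S else 0.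

Lemma chain_rep_new k (S : {set 'I_d}) : C k \subset S -> chain_rep k S = k.
Proof. by case: k => //= k ->. Qed.

Lemma chain_rep_le k S : chain_rep k S <= k.
Proof. by elim: k => //= k IH; case: ifP => // _; exact: leqW. Qed.

Lemma chain_rep_const k l (S : {set 'I_d}) : k <= l -> (forall i, k < i <= l -> ~~ (C i \subset S)) ->
  chain_rep l S = chain_rep k S.
Proof.
move=> /subnKC <-; elim: (l - k) => [|i IH] h; first by rewrite addn0.
rewrite addnS /= ifN; last by apply: h; lia.
by apply: IH => j hj; apply: h; lia.
Qed.

(** Disjointness is used twice. A vertex of [C k.+1] avoids [C k], so the facet of simplex [k]
    opposite to it is free. A face containing [~: C k.+1] contains [C k], so it is new in simplex
    [k] and no earlier simplex contains it, which is the frontier condition. *)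
Lemma chain_shelling M : C 0 = set0 ->
  (forall k, 0 < k < M -> 0 < #|C k| < d) ->
  (forall k, k.+1 < M -> [disjoint C k & C k.+1]) ->
  0 < d ->
  shelling C (fun k _ => k.-1) chain_rep M.
Proof.
move=> C0 cC dC d0; split.
- by move=> k /cC/andP[h _]; rewrite -card_gt0.
- move=> [|k] kM; apply/negP => /eqP E.
    by move: d0; rewrite -(card_ord d) -cardsT -E C0 cards0.
  by have := cC k.+1 kM; rewrite E cardsT card_ord ltnn andbF.
- by move=> k S _; exact: chain_rep_new.
- move=> [|k] v S kM vC vS; first by rewrite C0 inE in vC.
  by rewrite /= ifN//; apply/subsetPn; exists v.
- move=> [|k] v kM vC; first by rewrite C0 inE in vC.
  split => //=; first by rewrite (disjointFl (dC _ kM) vC).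
  by move=> [|j] jk vj /= E; [rewrite C0 inE in vj|lia].
- move=> [|k] l u S kM [lk uC _] uk uS AS; first by rewrite C0 inE in uk.
  rewrite [chain_rep k.+1 S]/= ifN; last by apply/subsetPn; exists u.
  have CkS : C k \subset S.
    apply: subset_trans AS; rewrite -disjoints_subset; exact: dC.
  rewrite (chain_rep_new CkS) /= => E; have := chain_rep_le l S; lia.
Qed.
End ChainShelling.

(** * Attaching one more simplex along facets of several earlier ones *)

Section ExtendShelling.
Variables (d : nat) (C : nat -> {set 'I_d}) (p : nat -> 'I_d -> nat)
  (rep : nat -> {set 'I_d} -> nat) (N : nat) (hold : 'I_d -> nat) (v0 : 'I_d).
Hypotheses (sh : shelling C p rep N) (CN : 0 < #|C N| < d).
Hypothesis hold_free : forall v, v \in C N -> free_facet C p N (hold v) v.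
Hypothesis hold_rep : forall v w (S : {set 'I_d}), v \in C N -> w \in C N -> v \notin S -> w \notin S ->
  rep (hold v) S = rep (hold w) S.
Hypothesis hold_unique : forall l u, free_facet C p N l u -> u \in C N -> l = hold u.

Definition extend_parent k v := if k == N then hold v else p k v.
(** By [hold_rep] the vertex picked does not matter; the default [v0] is never reached, since
    [C N :\: S] is nonempty in that branch. *)
Definition extend_rep k (S : {set 'I_d}) :=
  if k == N then if C N \subset S then N
    else rep (hold (odflt v0 [pick v in C N :\: S])) S
  else rep k S.

Lemma extend_free k l u : k <= N -> free_facet C extend_parent k l u <-> free_facet C p k l u.
Proof.
by move=> kN; split=> -[lk uC h]; split => // j jk uj; have := h j jk uj;
  rewrite /extend_parent ifN//; lia.
Qed.

(** The frontier condition for the new simplex is immediate: by [hold_unique] only one free facet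
    lies opposite to each vertex of [C N]. *)
Lemma extend_shelling : shelling C extend_parent extend_rep N.+1.
Proof.
have repE k S : k < N -> extend_rep k S = rep k S.
  by move=> kN; rewrite /extend_rep ifN//; lia.
have parE k v : k < N -> extend_parent k v = p k v.
  by move=> kN; rewrite /extend_parent ifN//; lia.
have eq_or_lt k : k < N.+1 -> k = N \/ k < N by lia.
split.
- move=> k /andP[k0 /eq_or_lt[->|kN]]; last by apply: (shelling_neq0 sh); rewrite k0.
  by rewrite -card_gt0; case/andP: CN.
- move=> k /eq_or_lt[->|kN]; last exact: (shelling_neqT sh).
  by apply/negP => /eqP E; move: CN; rewrite E cardsT card_ord ltnn andbF.
- move=> k S /eq_or_lt[->|kN] h; first by rewrite /extend_rep eqxx h.
  by rewrite repE//; exact: (shelling_new sh).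
- move=> k v S /eq_or_lt[->|kN] vC vS; last first.
    by rewrite parE// !repE//; [exact: (shelling_old sh)|exact: ltn_trans (parent_lt sh kN vC) kN].
  rewrite /extend_parent eqxx [in RHS]repE; last by have [] := hold_free vC.
  rewrite /extend_rep eqxx ifN; last by apply/subsetPn; exists v.
  case: pickP => [w|/(_ v)]; last by rewrite inE vC vS.
  by rewrite inE => /andP[wS wC]; exact: hold_rep.
- move=> k v /eq_or_lt[->|kN] vC; apply/extend_free => //; first by rewrite /extend_parent eqxx; exact: hold_free.
    exact: ltnW.
  by rewrite parE//; exact: (shelling_free sh).
- move=> k l u S /eq_or_lt[->|kN] /extend_free fr uC uS AS.
    by rewrite /extend_parent eqxx => _; apply: hold_unique => //; exact: fr.
  have lk : l < N by have [] := fr (ltnW kN) => h _ _; exact: ltn_trans kN.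
  rewrite !repE// parE// => E; apply: (shelling_frontier sh kN (fr (ltnW kN)) uC uS AS E).
Qed.
End ExtendShelling.

Lemma card_segment d a b : b <= d -> #|[set i : 'I_d | a <= i < b]| = b - a.
Proof.
move=> bd; rewrite -sum1dep_card -(big_mkord (fun i => a <= i < b) (fun=> 1)).
rewrite -[RHS]muln1 -sum_nat_const_nat.
have [ab|ba] := leqP a b; last first.
  rewrite [RHS]big_geq ?(ltnW ba)// big1 => // i; lia.
rewrite (big_cat_nat (n := b))//= [X in _ + X]big1_seq ?addn0; last first.
  by move=> i; rewrite mem_index_iota; lia.
rewrite (big_cat_nat (n := a))//= [X in X + _]big1_seq ?add0n; last first.
  by move=> i; rewrite mem_index_iota; lia.
by rewrite big_nat_cond [RHS]big_nat_cond; apply: eq_bigl => i; lia.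
Qed.

(** * Explicit vertex sets for a sequence of pairs of sizes *)

Section PairChain.
Variables (d P : nat) (a b : nat -> nat).
Hypotheses (a_gt0 : forall j, j < P -> 0 < a j) (b_gt0 : forall j, j < P -> 0 < b j)
  (ab_le : forall j, j < P -> a j + b j <= d)
  (a_anti : forall j, j.+1 < P -> a j.+1 <= a j).

Definition segment (x y : nat) : {set 'I_d} := [set i : 'I_d | x <= i < y].

Lemma card_seg x y : y <= d -> #|segment x y| = y - x.
Proof. exact: card_segment. Qed.

(** Simplices [2j+1] and [2j+2] carry pair [j] on two adjacent segments. Since [a] is nonincreasing,
    the next initial segment stops before the second segment of pair [j] begins, so consecutive sets
    are disjoint throughout. *)
Definition pair_set (k : nat) : {set 'I_d} :=
  if k is 0 then set0 else
  if odd k then segment 0 (a k./2) else segment (a k./2.-1) (a k./2.-1 + b k./2.-1).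

Arguments pair_set : simpl never.

Lemma pair_set_odd j : pair_set j.*2.+1 = segment 0 (a j).
Proof. by rewrite /pair_set /= odd_double /= uphalf_double. Qed.

Lemma pair_set_even j : pair_set j.*2.+2 = segment (a j) (a j + b j).
Proof. by rewrite /pair_set /= odd_double /= doubleK. Qed.

Lemma pair_index k : exists j, k = 0 \/ k = j.*2.+1 \/ k = j.*2.+2.
Proof.
case: k => [|k]; first by exists 0; left.
by exists k./2; right; have := odd_double_half k; case: (odd k) => /= h; [right|left]; lia.
Qed.

Lemma a_antiW i j : i <= j -> j < P -> a j <= a i.
Proof.
move=> /subnKC <-; elim: (j - i) => [|n IH]; first by rewrite addn0.
rewrite addnS => h; apply: leq_trans (a_anti h) (IH _); lia.
Qed.

Lemma card_pair_set k : 0 < k < P.*2.+1 -> 0 < #|pair_set k| < d.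
Proof.
have [j [->//|[->|->]]] := pair_index k => h.
  have jP : j < P by lia.
  have ? := a_gt0 jP; have ? := b_gt0 jP; have ? := ab_le jP.
  by rewrite pair_set_odd card_seg; lia.
have jP : j < P by lia.
have ? := a_gt0 jP; have ? := b_gt0 jP; have ? := ab_le jP.
by rewrite pair_set_even card_seg; lia.
Qed.

Lemma disjoint_segment x y x' y' : y <= x' \/ y' <= x ->
  [disjoint segment x y & segment x' y'].
Proof.
move=> h; rewrite disjoint_subset; apply/subsetP => i; rewrite !inE; lia.
Qed.

Lemma disjoint_pair_set k : k.+1 < P.*2.+1 -> [disjoint pair_set k & pair_set k.+1].
Proof.
have [j [->|[->|->]]] := pair_index k => h; first by rewrite disjoints_subset /pair_set sub0set.
  by rewrite pair_set_odd pair_set_even; apply: disjoint_segment; left.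
rewrite pair_set_even -doubleS pair_set_odd; apply: disjoint_segment; right.
by apply: a_anti; lia.
Qed.

Lemma sum_pair_set (K : nmodType) (F : nat -> K) :
  (\sum_(k < P.*2) F #|pair_set k.+1| = \sum_(j < P) (F (a j) + F (b j)))%R.
Proof.
suff H n : n <= P -> (\sum_(k < n.*2) F #|pair_set k.+1| = \sum_(j < n) (F (a j) + F (b j)))%R.
  exact: H.
elim: n => [|n IH] nP; first by rewrite !big_ord0.
rewrite doubleS !big_ord_recr/= IH ?(ltnW nP)// pair_set_odd pair_set_even.
have := ab_le nP => abd.
rewrite !card_seg ?subn0 ?addKn ?addrA//; lia.
Qed.

Lemma pair_chain_shelling : 0 < d ->
  shelling pair_set (fun k _ => k.-1) (chain_rep pair_set) P.*2.+1.
Proof. by apply: chain_shelling => //; [exact: card_pair_set|exact: disjoint_pair_set]. Qed.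

(** For an odd number of sizes: the unpaired middle one comes right after the first simplex and
    occupies the last [mid] vertices, out of reach of [segment 0 (a 0)]. *)
Lemma middle_chain_shelling mid : 0 < mid < d -> (0 < P -> a 0 + mid <= d) ->
  let C k := if k is k'.+1 then if k' is 0 then segment (d - mid) d else pair_set k' else set0 in
  shelling C (fun k _ => k.-1) (chain_rep C) P.*2.+2.
Proof.
move=> mid0 amid C; apply: chain_shelling => //; last by lia.
- move=> [//|[|k]] h; rewrite /C; first by rewrite card_seg; lia.
  by apply: card_pair_set; lia.
- move=> [|[|k]] h; rewrite /C; first by rewrite disjoints_subset sub0set.
    by rewrite (pair_set_odd 0); apply: disjoint_segment; right; have := amid; lia.
  by apply: disjoint_pair_set; lia.
Qed.

(** * The last simplex of case (b) *)

Section Closing.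
Variable n : nat.
Hypotheses (n_gt0 : 0 < n < d) (ab_ge : forall j, j < P -> d - n <= a j + b j).

Definition closing_set k : {set 'I_d} :=
  if k == P.*2.+1 then segment 0 (d - n) else pair_set k.

(* The pairs whose initial segment still contains [v] come first; the last simplex of the last
   of them carries the free facet opposite to [v]. *)
Definition holder_pair (v : 'I_d) : nat := find (fun j => a j <= v) (iota 0 P).

Lemma holder_pair_le v : holder_pair v <= P.
Proof. by rewrite -[leqRHS](size_iota 0) find_size. Qed.

Lemma lt_holder_pair (v : 'I_d) j : j < holder_pair v -> v < a j.
Proof.
move=> h; have := before_find 0 h; rewrite nth_iota ?add0n//; first by move/negbT; rewrite -ltnNge.
exact: leq_trans h (holder_pair_le v).
Qed.

Lemma ge_holder_pair (v : 'I_d) j : holder_pair v <= j -> j < P -> a j <= v.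
Proof.
move=> hj jP; have hP : holder_pair v < P by exact: leq_ltn_trans hj jP.
apply: leq_trans (a_antiW hj jP) _.
have := @nth_find _ 0 (fun j => a j <= v) (iota 0 P); rewrite has_find size_iota => /(_ hP).
by rewrite nth_iota ?add0n.
Qed.

Lemma closing_set_old k : k < P.*2.+1 -> closing_set k = pair_set k.
Proof. by move=> h; rewrite /closing_set ifN//; lia. Qed.

Lemma closing_chain_shelling :
  shelling closing_set (fun k _ => k.-1) (chain_rep closing_set) P.*2.+1.
Proof.
apply: chain_shelling => //; last by lia.
- by move=> k h; rewrite closing_set_old ?card_pair_set//; lia.
- by move=> k h; rewrite !closing_set_old ?disjoint_pair_set//; lia.
Qed.

(** Let [v < d - n] and let [m] be [holder_pair v]. Pair [j] contains [v] in its first set if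
    [j < m] and in its second set otherwise, so [v] belongs to the sets with indices 1, 3, ...,
    [2m-1] and [2m+2], [2m+4], ..., [2P]. The facet of simplex [l] opposite to [v] is free when [v]
    is neither in set [l] nor in the next set of the chain, and only [l = 2m] qualifies. *)
Lemma closing_shelling (v0 : 'I_d) :
  shelling closing_set
    (extend_parent (fun k _ => k.-1) P.*2.+1 (fun v => (holder_pair v).*2))
    (extend_rep closing_set (chain_rep closing_set) P.*2.+1 (fun v => (holder_pair v).*2) v0)
    P.*2.+2.
Proof.
have CN : closing_set P.*2.+1 = segment 0 (d - n) by rewrite /closing_set eqxx.
have inCN v : (v \in closing_set P.*2.+1) = (v < d - n) by rewrite CN inE.
apply: extend_shelling closing_chain_shelling _ _ _ _ => //.
- by rewrite CN card_seg; lia.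
- move=> v; rewrite inCN => vn; set m := holder_pair v.
  have mP : m <= P := holder_pair_le v.
  split; first by lia.
    rewrite closing_set_old; last by lia.
    case E : m => [|m']; first by rewrite inE.
    by rewrite doubleS pair_set_even inE; have := @lt_holder_pair v m'; rewrite -/m E; lia.
  move=> [|k] kN; first by rewrite closing_set_old// inE.
  rewrite closing_set_old// => vk /= E; move: vk kN; rewrite E pair_set_odd inE => vm kN.
  by have := @ge_holder_pair v m (leqnn _); lia.
(* By symmetry the holder of [w] comes first. Between the two holders every odd set contains [v] and
   every even set contains [w], so none lies in [S] and the descent runs from one holder down to the
   other. *)
- suff H (v w : 'I_d) (S : {set 'I_d}) : v < d - n -> w < d - n -> v \notin S -> w \notin S ->
      holder_pair w <= holder_pair v ->
      chain_rep closing_set (holder_pair v).*2 S = chain_rep closing_set (holder_pair w).*2 S.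
    move=> v w S; rewrite !inCN => vn wn vS wS.
    have [/H h|/ltnW/H h] := leqP (holder_pair w) (holder_pair v); first exact: h.
    by symmetry; exact: h.
  move=> vn wn vS wS wv; apply: chain_rep_const; first by rewrite leq_double.
  move=> i hi; have vP := holder_pair_le v; rewrite closing_set_old; last by lia.
  have [j [ij|[ij|ij]]] := pair_index i; subst i; first by lia.
    apply/subsetPn; exists v => //; rewrite pair_set_odd inE; apply: lt_holder_pair; lia.
  apply/subsetPn; exists w => //; rewrite pair_set_even inE.
  have jP : j < P by lia.
  by have := ab_ge jP; have := @ge_holder_pair w j; lia.
- move=> l u [lN ul h]; rewrite inCN => un; move: ul; rewrite closing_set_old// => ul.
  have {}h k : k.+1 < P.*2.+1 -> u \in pair_set k.+1 -> k <> l.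
    by move=> kP uk; have := h k.+1 kP; rewrite closing_set_old//; exact.
  have [j [lj|[lj|lj]]] := pair_index l; subst l.
  + suff : ~ 0 < holder_pair u by lia.
    move=> hu; apply: (h 0) => //; first by have := holder_pair_le u; lia.
    by rewrite (pair_set_odd 0) inE lt_holder_pair.
  + have jP : j < P by lia.
    exfalso; apply: (h j.*2.+1) => //; first by lia.
    by move: ul; rewrite pair_set_odd pair_set_even !inE; have := ab_ge jP; lia.
  + have jP : j < P by lia.
    have uj : u < a j by move: ul; rewrite pair_set_even !inE; have := ab_ge jP; lia.
    have j1 : j < holder_pair u by rewrite ltnNge; apply/negP => /ge_holder_pair/(_ jP); lia.
    suff : ~ j.+1 < holder_pair u by lia.
    move=> hu; apply: (h j.*2.+2) => //; first by have := holder_pair_le u; lia.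
    by rewrite -doubleS pair_set_odd inE lt_holder_pair.
Qed.
End Closing.
End PairChain.

(** * Arranging the types of the simplices *)

(** Translates bounds on entries into bounds on counts, the form in which the hypotheses on [dh]
    arrive. *)
Lemma sorted_nth_le (s : seq nat) i c : sorted leq s -> i < size s ->
  (nth 0 s i <= c) = (i < count (fun x => x <= c) s).
Proof.
elim: s i => // x s IH i /= xs.
have ss : sorted leq s := path_sorted xs.
have [xc|cx] := leqP x c; first by case: i => [|i] /= is_; rewrite ?xc// add1n ltnS IH.
have mn := order_path_min leq_trans xs.
have -> : count (fun x => x <= c) s = 0.
  apply/eqP; rewrite -leqn0 leqNgt -has_count -all_predC; apply: sub_all mn => y /=.
  by move=> xy; rewrite -ltnNge (leq_trans cx).
case: i => [|i] /= is_; rewrite ltn0; apply/negbTE; rewrite -ltnNge//.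
by apply: leq_trans cx _; move/all_nthP: mn; exact.
Qed.

Lemma nth_sorted_le (s : seq nat) i j : sorted leq s -> i <= j -> j < size s ->
  nth 0 s i <= nth 0 s j.
Proof.
by move=> ss ij js; apply: (sorted_leq_nth leq_trans leqnn) => //; rewrite inE //; exact: leq_ltn_trans js.
Qed.

Lemma sorted_multiset (c : nat -> nat) n : exists s : seq nat,
  [/\ sorted leq s,
      (forall x, x \in s -> x < n /\ 0 < c x),
      (forall P : pred nat, count P s = \sum_(i < n | P i) c i) &
      (forall (K : nmodType) (F : nat -> K), \sum_(x <- s) F x = \sum_(i < n) F i *+ c i)%R].
Proof.
pose t := flatten [seq nseq (c i) i | i <- iota 0 n].
have cnt (P : pred nat) : count P t = \sum_(i < n | P i) c i.
  rewrite /t count_flatten -!map_comp sumnE big_map -(big_mkord P) [RHS]big_mkcond/= /index_iota subn0.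
  by apply: eq_bigr => i _; rewrite /= count_nseq; case: (P i); rewrite ?mul1n ?mul0n.
exists (sort leq t); split.
- exact: (sort_sorted leq_total).
- move=> x; rewrite mem_sort => /flatten_mapP[i]; rewrite mem_iota add0n => /andP[_ ni].
  by rewrite mem_nseq => /andP[c0 /eqP ->].
- by move=> P; rewrite count_sort cnt.
- move=> K F; rewrite (perm_big t) ?perm_sort// /t big_flatten big_map/= -(big_mkord xpredT (fun i => F i *+ c i)%R).
  rewrite /index_iota subn0; apply: eq_bigr => i _.
  by rewrite big_nseq iter_addr addr0.
Qed.

(** * Pairing the sizes from the middle outwards *)

Section SortedPairs.
Variables (d : nat) (s : seq nat).
Hypotheses (ss : sorted leq s) (s_bounds : forall x, x \in s -> 0 < x < d).
Let q := size s.
Let o : nat := odd q.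
Let P := q./2.
(** The positions of [a j] and [b j] add up to [q.-1]; counting from the middle makes [a]
    nonincreasing, as the chain requires. *)
Let a j := nth 0 s (P.-1 - j).
Let b j := nth 0 s (P + o + j).

Let qE : q = P + o + P.
Proof. by rewrite /P /o -[LHS]odd_double_half -addnn; lia. Qed.

Let nth_bounds i : i < q -> 0 < nth 0 s i < d.
Proof. by move=> iq; apply/s_bounds/mem_nth. Qed.

Lemma sum_sorted_pairs (K : nmodType) (F : nat -> K) :
  (\sum_(x <- s) F x = (F (nth 0 s P) *+ o) + \sum_(j < P) (F (a j) + F (b j)))%R.
Proof.
rewrite (big_nth 0) -/q big_split/= addrCA.
rewrite (big_cat_nat (n := P))//=; last by lia.
congr (_ + _)%R.
  rewrite big_mkord (reindex_inj rev_ord_inj)/=; apply: eq_bigr => j _.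
  by congr (F (nth _ _ _)); have := ltn_ord j; lia.
rewrite (big_cat_nat (n := P + o))//=; [|lia|lia].
congr (_ + _)%R.
  case: (o =P 0) => [->|o0]; first by rewrite addn0 big_geq.
  have -> : o = 1 by move: o0; rewrite /o; case: (odd q).
  by rewrite addn1 big_nat1.
by rewrite -{1}[P + o]add0n big_addn qE addKn big_mkord; apply: eq_bigr => j _; rewrite addnC.
Qed.

Let P_lt j : j < P -> P.-1 - j < q /\ P + o + j < q.
Proof. by rewrite qE; lia. Qed.

Section Chain.
Hypothesis pair_le : forall i, i < P -> nth 0 s i + nth 0 s (q.-1 - i) <= d.

Let a_gt0 j : j < P -> 0 < a j. Proof. by move=> /P_lt[h _]; have /andP[] := nth_bounds h. Qed.
Let b_gt0 j : j < P -> 0 < b j. Proof. by move=> /P_lt[_ h]; have /andP[] := nth_bounds h. Qed.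
Let ab_le j : j < P -> a j + b j <= d.
Proof.
move=> jP; have := @pair_le (P.-1 - j); rewrite /a /b.
have -> : q.-1 - (P.-1 - j) = P + o + j by rewrite [q]qE; lia.
  by apply; lia.
Qed.
Let a_anti j : j.+1 < P -> a j.+1 <= a j.
Proof. by move=> jP; apply: nth_sorted_le => //; [lia|have [] := @P_lt j; lia]. Qed.

Lemma sorted_pairs_shelling : 0 < d -> exists C p rep M, [/\ 0 < M, shelling (d := d) C p rep M &
  (\sum_(k < M) 'X^#|C k| = 1 + \sum_(x <- s) 'X^x :> {poly int})%R].
Proof.
move=> d0; have E := sum_sorted_pairs (fun x => 'X^x : {poly int})%R.
have [oq|oq] := boolP (odd q); last first.
  have sh := pair_chain_shelling a_gt0 b_gt0 ab_le a_anti d0.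
  exists (pair_set d a b), (fun k _ => k.-1), (chain_rep (pair_set d a b)), P.*2.+1; split => //.
  rewrite E /o (negPf oq) mulr0n add0r big_ord_recl cards0 expr0; congr (_ + _)%R.
  by rewrite -(sum_pair_set ab_le (fun x => 'X^x : {poly int})%R).
have oE : o = 1 by rewrite /o oq.
have mid : 0 < nth 0 s P < d by apply: nth_bounds; lia.
have amid : 0 < P -> a 0 + nth 0 s P <= d.
  move=> P0; apply: leq_trans (ab_le P0); rewrite leq_add2l.
  by apply: nth_sorted_le => //; [lia|have [] := P_lt P0; lia].
have sh := middle_chain_shelling a_gt0 b_gt0 ab_le a_anti mid amid.
do 4 eexists; split; [|exact: sh|] => //.
rewrite E oE mulr1n big_ord_recl cards0 expr0; congr (_ + _)%R.
rewrite big_ord_recl/= card_seg// subKn; last by lia.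
congr (_ + _)%R.
by rewrite -(sum_pair_set ab_le (fun x => 'X^x : {poly int})%R).
Qed.

Lemma sorted_pairs_closing_shelling n : ~~ odd q -> 0 < n < d ->
  (forall i, i < P -> d - n <= nth 0 s i + nth 0 s (q.-1 - i)) ->
  exists C p rep M, [/\ 0 < M, shelling (d := d) C p rep M &
  (\sum_(k < M) 'X^#|C k| = 1 + \sum_(x <- s) 'X^x + 'X^(d - n) :> {poly int})%R].
Proof.
move=> oq n0 pair_ge.
have E := sum_sorted_pairs (fun x => 'X^x : {poly int})%R.
have ab_ge j : j < P -> d - n <= a j + b j.
  move=> jP; have := @pair_ge (P.-1 - j); rewrite /a /b.
  have -> : q.-1 - (P.-1 - j) = P + o + j by rewrite [q]qE; lia.
  by apply; lia.
have d0 : 0 < d by lia.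
have sh := closing_shelling a_gt0 b_gt0 ab_le a_anti n0 ab_ge (Ordinal d0).
do 4 eexists; split; [|exact: sh|] => //.
rewrite E /o (negPf oq) mulr0n add0r big_ord_recr/= {2}/closing_set eqxx card_seg; last by lia.
rewrite subn0; congr (_ + _)%R.
rewrite big_ord_recl cards0 expr0; congr (_ + _)%R.
rewrite -(sum_pair_set ab_le (fun x => 'X^x : {poly int})%R).
by apply: eq_bigr => k _; rewrite lift0 closing_set_old// ltnS; exact: ltn_ord.
Qed.
End Chain.

Let i_lt i : i < P -> i < q /\ q.-1 - i < q.
Proof. by rewrite qE; lia. Qed.

Let count_ge y : count (fun x => y <= x) s + count (fun x => x < y) s = q.
Proof.
rewrite addnC /q -(count_predC (fun x => x < y) s); congr (_ + _).
by apply: eq_count => x /=; rewrite -leqNgt.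
Qed.

Let count_lt y : 0 < y -> count (fun x => x < y) s = count (fun x => x <= y.-1) s.
Proof. by move=> y0; apply: eq_count => x; lia. Qed.

(** If entries [x <= y] at positions [i] and [q.-1 - i] had [x + y > d], take [l = d - y], which is
    in range because [2y > d]. At least [i+1] entries are [>= y = d - l], but at most [i] are
    [<= l], since [x] exceeds [l]. *)
Lemma sorted_pair_le :
  (forall l, l <= d.-1./2 -> count (fun x => d - l <= x) s <= count (fun x => x <= l) s) ->
  forall i, i < P -> nth 0 s i + nth 0 s (q.-1 - i) <= d.
Proof.
move=> L i iP; have [iq iq'] := i_lt iP.
rewrite leqNgt; apply/negP => gt.
have xy : nth 0 s i <= nth 0 s (q.-1 - i) by apply: nth_sorted_le => //; lia.
have := nth_bounds iq'; set y := nth 0 s (q.-1 - i) in gt xy * => yb.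
have := L (d - y); rewrite subKn; last by lia.
have hy : ~~ (y <= y.-1) by lia.
move: hy; rewrite {1}/y sorted_nth_le// -leqNgt -count_lt; last by lia.
have := count_ge y.
have hx : ~~ (nth 0 s i <= d - y) by lia.
move: hx; rewrite sorted_nth_le// -leqNgt; lia.
Qed.

(** If [x + y < d - n], take [l = x + n]: at least [i+1] entries are [<= l - n], but at most [i] are
    [>= d - l]. This [l] is out of range only if [x + n >= d - n]; then [y <= n], so more than half
    of the entries are at most [n], against the last hypothesis. *)
Lemma sorted_pair_ge n : 0 < n ->
  (forall l, n < l < d - n -> count (fun x => x <= l - n) s <= count (fun x => d - l <= x) s) ->
  (count (fun x => x <= n) s).*2 <= q ->
  forall i, i < P -> d - n <= nth 0 s i + nth 0 s (q.-1 - i).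
Proof.
move=> n0 U cn i iP; have [iq iq'] := i_lt iP.
rewrite leqNgt; apply/negP => lt.
have /andP[x0 _] := nth_bounds iq; set x := nth 0 s i in lt x0.
have [h|h] := leqP (d - n) (x + n).
  have : nth 0 s (q.-1 - i) <= n by lia.
  by rewrite sorted_nth_le//; lia.
have /U : n < x + n < d - n by lia.
rewrite addnK.
have : nth 0 s i <= x by [].
rewrite sorted_nth_le// => hx.
have : nth 0 s (q.-1 - i) <= (d - (x + n)).-1 by lia.
rewrite sorted_nth_le// -count_lt; last by lia.
have := count_ge (d - (x + n)); lia.
Qed.
End SortedPairs.

Lemma sum_indicator N k : \sum_(i < N) (i == k :> nat) = (k < N).
Proof.
elim: N => [|N IH]; first by rewrite big_ord0.
by rewrite big_ord_recr/= IH; lia.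
Qed.

Lemma sum_low (c : nat -> nat) d l : l <= d ->
  \sum_(i < d.+1 | i <= l) c i = \sum_(i < l.+1) c i.
Proof.
by move=> ld; rewrite (big_ord_widen_cond d.+1 xpredT c).
Qed.

Lemma sum_high (c : nat -> nat) d l : l <= d ->
  \sum_(i < d.+1 | d - l <= i) c i = \sum_(i < l.+1) c (d - i).
Proof.
move=> ld; rewrite (reindex_inj rev_ord_inj)/= -(sum_low (fun i => c (d - i)) ld).
by apply: eq_big => i; have := ltn_ord i; rewrite subSS; [lia|].
Qed.

(** The window of [n] terms is the upper bound on [dh] in case (b). Cancelling it leaves a
    comparison between the sum of [h] up to [l - n] and the sum of its last [l+1] entries. *)
Lemma sum_window (f : nat -> nat) n l : n <= l ->
  \sum_(i < l.+1) f i = \sum_(i < (l - n).+1) f i + \sum_(0 <= i < n) f (l - i).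
Proof.
elim: n => [|n IH] nl; first by rewrite subn0 big_geq ?addn0.
rewrite IH ?(ltnW nl)// big_nat_recr//= -(subSn nl) subSS big_ord_recr/=; lia.
Qed.

Lemma dhE d h l : (dh d h l = (\sum_(i < l.+1) nth 0%N h i)%:Z -
  (\sum_(i < l.+1) nth 0%N h (d - i))%:Z)%R.
Proof. by rewrite /dh sumrB !big_mkord -!natz !natr_sum; congr (_ - _)%R; apply: eq_bigr => i _; rewrite natz. Qed.

(** * Weights on chains of subsets *)

Section ChainDecomposition.
Local Open Scope ring_scope.
Variables (R : realFieldType) (I : finType).
Implicit Types (g : {set I} -> R) (x : I -> R) (S : {set I}).

(** A point of the barycentric subdivision of a simplex, with each weight divided by the size of its
    set, so that coordinate [i] of the point is the sum of [g S] over the sets [S] containing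
    [i]. *)
Record chain_weight g : Prop := ChainWeight {
  chain_ge0 : forall S, 0 <= g S;
  chain_set0 : g set0 = 0;
  chain_total : forall S S', 0 < g S -> 0 < g S' -> (S \subset S') || (S' \subset S) }.

(** A set of positive weight containing [j] is comparable with [S] but not inside it, so it contains
    [S] and hence [i]; the weight of [S] itself makes the inequality strict. *)
Lemma chain_weight_level g S i j : chain_weight g -> 0 < g S -> i \in S -> j \notin S ->
  \sum_(S' : {set I} | j \in S') g S' < \sum_(S' : {set I} | i \in S') g S'.
Proof.
move=> cg gS iS jS.
rewrite (bigD1 S iS)/=.
apply: (@le_lt_trans _ _ (\sum_(S' : {set I} | (i \in S') && (S' != S)) g S')); last by rewrite ltrDr.
rewrite big_mkcond [leRHS]big_mkcond/=; apply: ler_sum => S' _.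
case: ifPn => jS'; last by case: ifP => // _; exact: chain_ge0.
case: ifPn => // nS'.
rewrite leNgt; apply/negP => gS'; move/negP: nS'; apply.
have S'S : S' != S by apply: contraNneq jS => <-.
rewrite S'S andbT; have /orP[/subsetP/(_ _ iS)//|/subsetP/(_ _ jS')] := chain_total cg gS gS'.
by rewrite (negPf jS).
Qed.

(** By [chain_weight_level], incomparable sets charged by [g] and [g'] would order two coordinates
    in both ways. So the sets where [g] and [g'] differ form a chain, and a vertex of the largest
    one outside the next largest sees a single difference. *)
Lemma chain_weight_inj g g' : chain_weight g -> chain_weight g' ->
  (forall i, \sum_(S : {set I} | i \in S) g S = \sum_(S : {set I} | i \in S) g' S) -> g =1 g'.
Proof.
move=> cg cg' E.
have comp S S' : g S != g' S -> g S' != g' S' -> (S \subset S') || (S' \subset S).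
  have pos T : g T != g' T -> 0 < g T \/ 0 < g' T.
    move=> h; have := chain_ge0 cg T; have := chain_ge0 cg' T.
    rewrite !le_eqVlt => /predU1P[h'|]; last by right.
    by move=> /predU1P[h2|]; [rewrite -h' -h2 eqxx in h|left].
  have cross T T' : 0 < g T -> 0 < g' T' -> (T \subset T') || (T' \subset T).
    move=> gT gT'; apply/negPn/negP; rewrite negb_or => /andP[/subsetPn[i iT iT'] /subsetPn[j jT' jT]].
    have := chain_weight_level cg gT iT jT; have := chain_weight_level cg' gT' jT' iT'.
    by rewrite -!E => h1 /(lt_trans h1); rewrite ltxx.
  move=> /pos[h|h] /pos[h'|h'].
  - exact: (chain_total cg).
  - exact: cross.
  - by rewrite orbC; exact: cross.
  - exact: (chain_total cg').
move=> T; apply/eqP/negPn/negP => nT.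
pose S := [arg max_(S > T | g S != g' S) #|S|].
have [nS maxS] : g S != g' S /\ forall S', g S' != g' S' -> (#|S'| <= #|S|)%N.
  by rewrite /S; case: arg_maxnP.
(* [set0] stands in for the next largest set when [S] is the only difference. *)
pose P S' := (S' == set0) || ((g S' != g' S') && (S' != S)).
pose S2 := [arg max_(S' > set0 | P S') #|S'|].
have [PS2 maxS2] : P S2 /\ forall S', P S' -> (#|S'| <= #|S2|)%N.
  by rewrite /S2; case: arg_maxnP => //; rewrite /P eqxx.
have S0 : S != set0 by apply: contraNneq nS => ->; rewrite (chain_set0 cg) (chain_set0 cg').
have nSS2 : ~~ (S \subset S2).
  case/orP: PS2 => [/eqP ->|/andP[n2 S2S]]; first by rewrite subset0.
  apply/negP => SS2; move/negP: S2S; apply; rewrite eq_sym eqEcard SS2/=; exact: maxS.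
have [i iS iS2] := subsetPn nSS2.
have : \sum_(S' : {set I} | i \in S') (g S' - g' S') = 0 by rewrite sumrB E subrr.
rewrite (bigD1 S iS)/= big1 ?addr0 => [/eqP|S' /andP[iS' S'S]]; first by rewrite subr_eq0 (negPf nS).
apply/eqP; rewrite subr_eq0; apply/negPn/negP => nS'.
have PS' : P S' by rewrite /P nS' S'S orbT.
move/negP: iS2; apply.
have cS' := maxS2 _ PS'.
case/orP: PS2 => [/eqP E0|/andP[n2 S2S]].
  by move: cS' iS'; rewrite E0 cards0 leqn0 cards_eq0 => /eqP ->; rewrite inE.
have /orP[/subsetP|S2S'] := comp _ _ nS' n2; first exact.
by have /eqP -> : S2 == S' by rewrite eqEcard S2S'.
Qed.

(** Peel off levels: the least positive coordinate becomes the weight of the whole support and is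
    subtracted there. The support shrinks strictly, and all later sets lie inside it. *)
Lemma chain_weight_exists x : (forall i, 0 <= x i) ->
  exists g, [/\ chain_weight g, (forall S, 0 < g S -> S \subset [set i | 0 < x i]) &
    forall i, \sum_(S : {set I} | i \in S) g S = x i].
Proof.
have [n] := ubnP #|[set i | 0 < x i]|; elim: n x => // n IH x; rewrite ltnS => cn x0.
have [E|/set0Pn[i0 i0S]] := eqVneq [set i | 0 < x i] set0.
  exists (fun=> 0); split => [|S|i]; [by split => // S S'; rewrite ltxx|by rewrite ltxx|].
  rewrite big1//; symmetry; apply/eqP; rewrite eq_le x0 andbT leNgt.
  by apply/negP => xi; have : i \in [set i | 0 < x i]; [rewrite inE|rewrite E inE].
pose j := [arg min_(i < i0 in [set i | 0 < x i]) x i]%O.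
have [jS jmin] : j \in [set i | 0 < x i] /\ forall i, i \in [set i | 0 < x i] -> x j <= x i.
  by rewrite /j; case: arg_minP.
set S0 := [set i | 0 < x i] in cn jS jmin *.
have mu0 : 0 < x j by move: jS; rewrite inE.
pose x' i := x i - (if i \in S0 then x j else 0).
have x'0 i : 0 <= x' i by rewrite /x' subr_ge0; case: ifP => // iS; exact: jmin.
have sub : [set i | 0 < x' i] \subset S0 :\ j.
  apply/subsetP => i; rewrite !inE /x'; case: (boolP (i \in S0)) => [iS h|].
    have -> : 0 < x i by move: iS; rewrite inE.
    by rewrite andbT; apply: contraTneq h => ->; rewrite subrr ltxx.
  by rewrite inE => /negPf h; rewrite subr0 h.
have S'n : (#|[set i | (0 < x' i)%R]| < n)%N.
  apply: leq_ltn_trans (subset_leq_card sub) _; move: cn; rewrite (cardsD1 j S0) jS.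
  by case: n {IH} => // n; rewrite ltnS.
have [g' [cg' gs' gx']] := IH _ S'n x'0.
have g'S S : 0 < g' S -> S \subset S0 :\ j by move=> /gs' h; exact: subset_trans sub.
have g'S0 : g' S0 = 0.
  apply/eqP; rewrite eq_le (chain_ge0 cg') andbT leNgt; apply/negP => /g'S/subsetP/(_ _ jS).
  by rewrite !inE eqxx.
exists (fun S => g' S + (if S == S0 then x j else 0)); split.
- split => [S||S S'].
  + by rewrite addr_ge0 ?(chain_ge0 cg')//; case: ifP => // _; exact: ltW.
  + rewrite (chain_set0 cg') add0r ifF//; apply/negP => /eqP E.
    by move: jS; rewrite -E inE.
  + have D1 : S0 :\ j \subset S0 by exact: subD1set.
    case: eqP => [->|_]; case: eqP => [->|_]; rewrite ?addr0 ?subxx//.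
    * by move=> _ /g'S h; rewrite (subset_trans h D1) orbT.
    * by move=> /g'S h; rewrite (subset_trans h D1).
    * exact: (chain_total cg').
- move=> S; case: eqP => [->//|_]; rewrite addr0 => /g'S h.
  by apply: subset_trans h _; exact: subD1set.
- move=> i; rewrite big_split/= gx' /x' -big_mkcondr/=.
  case: (boolP (i \in S0)) => iS; last first.
    rewrite subr0 big1 ?addr0// => S /andP[iS' /eqP SS]; by move: iS; rewrite -SS iS'.
  rewrite (eq_bigl (pred1 S0)) ?big_pred1_eq ?subrK// => S.
  by rewrite inE/= andb_idl// => /eqP ->.
Qed.
End ChainDecomposition.

(** * The ball swept out by a shelling *)

From mathcomp Require Import all_classical all_reals all_analysis.
From mathcomp Require Import Rstruct Rstruct_topology.
From Stdlib Require Rdefinitions.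
Require Import Defs.
Import Order.TTheory GRing.Theory Num.Theory.
Import numFieldNormedType.Exports.

(** * Continuity from compact pieces, and minima of coordinates on the simplex *)

Section Continuity.
Local Open Scope ring_scope.
Local Open Scope classical_set_scope.
Variable R : realType.

(** Each compact piece consists of points sent to [u], near which [g \o f i] is close to [g u], and
    of points sent elsewhere, near which [f i] avoids a neighbourhood of [u]; compactness makes one
    neighbourhood of [u] serve the whole piece. The lemma pastes maps when [f i] is the identity and
    inverts a continuous bijection when [g \o f i] is. *)
Lemma within_continuous_quotient (T1 T2 T3 : normedModType R) (I : finType)
  (X : I -> set T1) (f : I -> T1 -> T2) (K : set T2) (g : T2 -> T3) :
  (forall i, compact (X i)) ->
  (forall i, {within X i, continuous (f i)}) ->
  (forall i, {within X i, continuous (g \o f i)}) ->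
  (forall u, K u -> exists i, exists2 x, X i x & f i x = u) ->
  {within K, continuous g}.
Proof.
move=> cX cf cgf XK; apply/subspace_continuousP => u Ku.
apply/cvgrPdist_lt => e e0.
have step (i : I) : \forall v \near u, forall x, X i x -> f i x = v ->
    `|g u - g v| < e.
  have /compact_near_coveringP/near_covering_withinP cov := cX i.
  apply: (cov _ (nbhs u) (fun v x => f i x = v -> `|g u - g v| < e)) => x Xx.
  have [fxu|/eqP fxu] := pselect (f i x = u).
    have /subspace_continuousP/(_ x Xx)/cvgrPdist_lt/(_ e e0) := cgf i.
    rewrite near_withinE => H.
    near=> y v => Xy <-; rewrite -fxu.
    have : X i y -> `|g (f i x) - g (f i y)| < e by near: y; exact: H.
    by apply.
  have d0 : 0 < `|f i x - u| / 2 by rewrite divr_gt0// normr_gt0 subr_eq0.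
  have /subspace_continuousP/(_ x Xx)/cvgrPdist_lt/(_ _ d0) := cf i.
  rewrite near_withinE => H.
  near=> y v => Xy fyv; exfalso.
  have h1 : X i y -> `|f i x - f i y| < `|f i x - u| / 2 by near: y; exact: H.
  have h2 : `|u - v| < `|f i x - u| / 2.
    by near: v; apply: (@cvgr_dist_lt _ _ _ (nbhs u) _ id u).
  have := ler_normD (f i x - f i y) (v - u).
  rewrite fyv addrA subrK -(distrC u v); move: (h1 Xy); rewrite fyv; lra.
rewrite near_withinE; near=> v => Kv.
have [i [x Xx fx]] := XK _ Kv.
have : forall i x, X i x -> f i x = v -> `|g u - g v| < e.
  by near: v; exact: filter_forall step.
by apply; eassumption.
Unshelve. all: by end_near. Qed.

Lemma comp_within_continuous (T1 T2 T3 : normedModType R) (X : set T1) (Y : set T2)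
    (f : T1 -> T2) (g : T2 -> T3) :
  (forall x, X x -> Y (f x)) -> {within X, continuous f} -> {within Y, continuous g} ->
  {within X, continuous (g \o f)}.
Proof.
move=> XY cf cg; apply/subspace_continuousP => x Xx.
apply/cvgrPdist_lt => e e0.
have /subspace_continuousP/(_ _ (XY _ Xx))/cvgrPdist_lt/(_ e e0) := cg.
rewrite near_withinE => H.
have /subspace_continuousP/(_ _ Xx) cfx := cf.
have := cfx _ H; rewrite !near_withinE => H2.
near=> y => Xy.
have : X y -> Y (f y) -> `|g (f x) - g (f y)| < e by near: y; exact: H2.
by apply => //; exact: XY.
Unshelve. all: by end_near. Qed.

Lemma cvg_rV (m : nat) (T : Type) (F : set_system T) (f : T -> 'rV[R]_m)
    (a : 'rV[R]_m) : Filter F ->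
  (forall j, f x ord0 j @[x --> F] --> a ord0 j) -> f x @[x --> F] --> a.
Proof.
move=> FF cf; rewrite (row_sum_delta a).
rewrite (_ : f = fun x => \sum_j f x ord0 j *: delta_mx ord0 j); last first.
  by apply/funext => x; exact: row_sum_delta.
apply: (@cvg_big 'rV[R]_m 'I_m +%R 0 xpredT (@add_continuous 'rV[R]_m)) => j _.
by apply: cvgZ; [exact: cf|exact: cvg_cst].
Qed.

Section Simplex.
Variable d : nat.

Definition simplex : set 'rV[R]_d :=
  [set x | (forall i, 0 <= x ord0 i) /\ \sum_i x ord0 i = 1].

Definition supp (x : 'rV[R]_d) : {set 'I_d} := [set i | 0 < x ord0 i].

(** The initial value 1 does not interfere for nonempty [A], as coordinates on the simplex are at
    most 1. *)
Definition mincoord (A : {set 'I_d}) (x : 'rV[R]_d) : R :=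
  \big[Num.min/1]_(i in A) x ord0 i.

Lemma sum_coord_continuous (c : 'I_d -> R) :
  continuous (fun x : 'rV[R]_d => \sum_i c i * x ord0 i).
Proof.
apply: (@continuous_big R 'I_d +%R 0 xpredT (@add_continuous R) _ (index_enum _)
  (fun i (x : 'rV[R]_d) => c i * x ord0 i)) => i _ x.
by apply: (@cvgM R 'rV[R]_d (nbhs x) _ (fun=> c i)); [exact: cvg_cst|exact: coord_continuous].
Qed.

Lemma mincoord_continuous (A : {set 'I_d}) : continuous (mincoord A).
Proof.
apply: (@continuous_big R 'I_d Num.min 1 (mem A) _ _ (index_enum _)
  (fun i (x : 'rV[R]_d) => x ord0 i)) => [x|i _ x].
  apply: (@continuous_min R (R^o * R^o)%type fst snd); [exact: cvg_fst|exact: cvg_snd].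
exact: coord_continuous.
Qed.

Lemma compact_rV_bounded_closed (A : set 'rV[R]_d) (B : R) : 
  closed A -> (forall x, A x -> forall i, `|x ord0 i| <= B) -> compact A.
Proof.
move=> cA bA; apply: (subclosed_compact cA (rV_compact (fun=> segment_compact (a := - B) (b:=B)))).
by move=> x Ax i /=; rewrite in_itv/= -ler_norml bA.
Qed.

Lemma simplex_le1 x i : simplex x -> x ord0 i <= 1.
Proof.
move=> [x0 <-]; rewrite (bigD1 i)//= lerDl; exact: sumr_ge0.
Qed.

Lemma simplex_compact : compact simplex.
Proof.
apply: (@compact_rV_bounded_closed _ 1); last first.
  by move=> x Dx i; have := Dx.1 i; move=> h; rewrite ger0_norm// simplex_le1.
have -> : simplex = \bigcap_(i in [set: 'I_d]) [set x | 0 <= x ord0 i] `&` 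
   [set x | \sum_i 1 * x ord0 i = 1].
  have sE (x : 'rV[R]_d) : \sum_i 1 * x ord0 i = \sum_i x ord0 i.
    by apply: eq_bigr => i _; rewrite mul1r.
  apply/seteqP; split => x/=; rewrite sE => -[x0 x1]; split => // i.
    by move=> _; exact: x0.
  exact: (x0 i I).
apply: closedI.
  apply: closed_bigI => i _.
  by apply: (closed_comp (f := fun x : 'rV[R]_d => x ord0 i)) (@closed_ge R 0) => x _; exact: coord_continuous.
by apply: (closed_comp (f := fun x : 'rV[R]_d => \sum_i 1 * x ord0 i)) (@closed_eq R 1) => x _; exact: sum_coord_continuous.
Qed.

Lemma mincoord_leP (A : {set 'I_d}) (x : 'rV[R]_d) (c : R) : reflect (c <= 1 /\ forall i, i \in A -> c <= x ord0 i)
  (c <= mincoord A x).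
Proof. exact: bigmin_geP. Qed.

Lemma mincoord_le (A : {set 'I_d}) (x : 'rV[R]_d) i : i \in A -> mincoord A x <= x ord0 i.
Proof. by move=> iA; exact: (bigmin_le_cond _ (fun i => x ord0 i)). Qed.

Lemma mincoord_attained (A : {set 'I_d}) (x : 'rV[R]_d) : simplex x -> A != finset.set0 ->
  exists2 i, i \in A & x ord0 i = mincoord A x.
Proof.
move=> Dx /set0Pn[j jA].
have [i iA E] := eq_bigmin (x := 1) j (mem A) (fun i => x ord0 i) jA (fun i _ => simplex_le1 i Dx).
by exists i.
Qed.

Lemma mincoord_ge0 (A : {set 'I_d}) (x : 'rV[R]_d) : simplex x -> 0 <= mincoord A x.
Proof. by move=> Dx; apply/mincoord_leP; split => // i _; exact: Dx.1. Qed.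

End Simplex.
End Continuity.

(** * A single simplex is a ball *)

Section SimplexToBall.
Local Open Scope ring_scope.
Local Open Scope classical_set_scope.
Variables (R : realType) (m : nat).
Implicit Types x y : 'rV[R]_m.+1.
Let c : R := m.+1%:R^-1.

Definition affine_chart x : 'rV[R]_m := \row_i (x ord0 (lift ord0 i) - c).
(** The Minkowski gauge of the simplex about its barycentre: 0 there and 1 on the boundary.
    [simplex_to_ball] rescales each ray so that the norm becomes the gauge. *)
Definition simplex_gauge x : R := 1 - m.+1%:R * mincoord [set: 'I_m.+1] x.
Definition simplex_to_ball x : 'rV[R]_m :=
  (simplex_gauge x / `|affine_chart x|) *: affine_chart x.

Let mc : m.+1%:R * c = 1. Proof. by rewrite mulfV// pnatr_eq0. Qed.
Let c0 : 0 < c. Proof. by rewrite invr_gt0 ltr0n. Qed.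

Lemma sum_sub_barycenter x : simplex x -> \sum_i (x ord0 i - c) = 0.
Proof.
by move=> Dx; rewrite sumrB Dx.2 sumr_const card_ord -mulr_natl mc subrr.
Qed.

Lemma affine_chart_scale x y t : simplex x -> simplex y ->
  affine_chart x = t *: affine_chart y -> forall i, x ord0 i - c = t * (y ord0 i - c).
Proof.
move=> Dx Dy E.
have El (i : 'I_m) : x ord0 (lift ord0 i) - c = t * (y ord0 (lift ord0 i) - c).
  by move/rowP: E => /(_ i); rewrite !mxE.
move=> i; case: (unliftP ord0 i) => [j ->|->] //.
have := sum_sub_barycenter Dx; have := sum_sub_barycenter Dy.
rewrite !big_ord_recl/= => Ey Ex.
have -> : x ord0 ord0 - c = - \sum_(i < m) (x ord0 (lift ord0 i) - c) by lra.
have -> : y ord0 ord0 - c = - \sum_(i < m) (y ord0 (lift ord0 i) - c) by lra.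
by rewrite mulrN mulr_sumr; congr (- _); apply: eq_bigr => j _.
Qed.

Lemma affine_chart_inj x y : simplex x -> simplex y ->
  affine_chart x = affine_chart y -> x = y.
Proof.
move=> Dx Dy E; apply/rowP => i.
have := @affine_chart_scale x y 1 Dx Dy; rewrite scale1r => /(_ E i); lra.
Qed.

Lemma mincoord_min x : simplex x -> exists i, forall j, x ord0 i <= x ord0 j /\ x ord0 i = mincoord [set: 'I_m.+1] x.
Proof.
move=> Dx; have [|i _ xi] := @mincoord_attained _ _ [set: 'I_m.+1]%SET _ Dx.
  by apply/set0Pn; exists ord0; rewrite inE.
by exists i => j; split => //; rewrite xi mincoord_le// inE.
Qed.

Lemma simplex_gauge_ge0 x : simplex x -> 0 <= simplex_gauge x.
Proof.
move=> Dx; rewrite /simplex_gauge subr_ge0.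
rewrite -[leRHS]Dx.2 -[X in X%:R * _]card_ord mulr_natl -sumr_const.
by apply: ler_sum => i _; rewrite mincoord_le// inE.
Qed.

Lemma simplex_gauge_le1 x : simplex x -> simplex_gauge x <= 1.
Proof.
move=> Dx; rewrite /simplex_gauge lerBlDr lerDl mulr_ge0//; exact: mincoord_ge0.
Qed.

Lemma simplex_gauge_eq0 x : simplex x -> (simplex_gauge x = 0) <-> (affine_chart x = 0).
Proof.
move=> Dx; have [i xi] := mincoord_min Dx; rewrite /simplex_gauge.
have [_ xim] := xi i; rewrite -xim; split => [E|E].
  have xic : x ord0 i = c.
    by apply: (@mulfI _ m.+1%:R); rewrite ?pnatr_eq0// mc; lra.
  have h0 : forall j, 0 <= x ord0 j - c by move=> j; rewrite subr_ge0 -xic (xi j).1.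
  have /eqP := sum_sub_barycenter Dx; rewrite psumr_eq0// => /allP h.
  apply/rowP => j; rewrite !mxE; apply/eqP.
  by have := h (lift ord0 j) (mem_index_enum _).
have := @affine_chart_scale x x 0 Dx Dx; rewrite scale0r => /(_ E i).
rewrite mul0r => /eqP; rewrite subr_eq0 => /eqP ->.
by rewrite mc subrr.
Qed.

Lemma simplex_gauge_eq1 x : simplex x -> (simplex_gauge x = 1) <-> (exists i, x ord0 i = 0).
Proof.
move=> Dx; have [i xi] := mincoord_min Dx; rewrite /simplex_gauge.
have [_ xim] := xi i; rewrite -xim; split => [E|[j xj]].
  exists i; apply: (@mulfI _ m.+1%:R); rewrite ?pnatr_eq0// mulr0; lra.
have -> : x ord0 i = 0.
  by apply/eqP; rewrite eq_le Dx.1 -xj (xi j).1.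
by rewrite mulr0 subr0.
Qed.

Lemma norm_simplex_to_ball x : simplex x -> `|simplex_to_ball x| = simplex_gauge x.
Proof.
move=> Dx; rewrite /simplex_to_ball normrZ normrM normfV normr_id.
rewrite (ger0_norm (simplex_gauge_ge0 Dx)).
have [/eqP h|h] := eqVneq (affine_chart x) 0; last by rewrite divfK// normr_eq0.
by move/eqP: h => /(simplex_gauge_eq0 Dx) ->; rewrite !mul0r.
Qed.

Lemma affine_chart_continuous : continuous affine_chart.
Proof.
move=> x; apply: (@cvg_rV R m _ (nbhs x)) => j.
rewrite (_ : (fun y : 'rV[R]_m.+1 => affine_chart y ord0 j) = 
   (fun y => y ord0 (lift ord0 j) - c)); last by apply/funext => y; rewrite mxE.
by rewrite mxE; apply: cvgB; [exact: coord_continuous|exact: cvg_cst].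
Qed.

Lemma simplex_gauge_continuous : continuous simplex_gauge.
Proof.
move=> x; apply: (@cvgB R R^o _ (nbhs x) _ (fun=> 1)); first exact: cvg_cst.
by apply: (@cvgM R _ (nbhs x) _ (fun=> m.+1%:R)); [exact: cvg_cst|exact: mincoord_continuous].
Qed.

Lemma simplex_to_ball_continuous : {within simplex (d := m.+1), continuous simplex_to_ball}.
Proof.
apply/subspace_continuousP => x Dx.
(* At the barycentre the quotient in [simplex_to_ball] degenerates, but the norm of the image is the
   gauge, which tends to 0. *)
have [/eqP w0|w0] := eqVneq (affine_chart x) 0.
  move/eqP: w0 => w0; have g0 := (simplex_gauge_eq0 Dx).2 w0.
  have s0 : simplex_to_ball x = 0 by rewrite /simplex_to_ball w0 scaler0.
  apply/cvgrPdist_lt => e e0; rewrite near_withinE.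
  have := @cvgr_dist_lt R R^o _ (nbhs x) _ simplex_gauge _ (@simplex_gauge_continuous x) e e0.
  move=> H; near=> y => Dy.
  have h : `|simplex_gauge x - simplex_gauge y| < e by near: y; exact: H.
  move: h; rewrite g0 sub0r normrN => h.
  suff : `|simplex_to_ball x - simplex_to_ball y| < e by [].
  rewrite s0 sub0r normrN norm_simplex_to_ball//; exact: le_lt_trans (ler_norm _) h.
apply: cvg_within_filter; apply: cvgZ; last exact: affine_chart_continuous.
apply: cvgM; first exact: simplex_gauge_continuous.
apply: cvgV; first by rewrite normr_eq0.
by apply: cvg_norm; exact: affine_chart_continuous.
Unshelve. all: by end_near. Qed.

(** Points with equal images lie on one ray from the barycentre, with deviations from [c]
    proportional by a factor [t]. The least deviation is the gauge up to a constant factor, and the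
    gauges agree, so [t = 1]. *)
Lemma simplex_to_ball_inj x y : simplex x -> simplex y ->
  simplex_to_ball x = simplex_to_ball y -> x = y.
Proof.
move=> Dx Dy E.
have gE : simplex_gauge x = simplex_gauge y.
  by rewrite -!norm_simplex_to_ball// E.
have [/eqP w0|w0] := eqVneq (affine_chart x) 0.
  move/eqP: w0 => w0; apply: affine_chart_inj => //; rewrite w0; symmetry.
  by apply/(simplex_gauge_eq0 Dy); rewrite -gE; apply/simplex_gauge_eq0.
have gx0 : simplex_gauge x != 0 by apply: contra_neq w0 => /simplex_gauge_eq0; apply.
set t := `|affine_chart x| / `|affine_chart y|.
have Ew : affine_chart x = t *: affine_chart y.
  apply: (@scalerI _ _ (simplex_gauge x / `|affine_chart x|)).
    by rewrite mulf_neq0// invr_eq0 normr_eq0.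
  rewrite scalerA /t mulrA divfK ?normr_eq0//; rewrite [X in _ = (X / _) *: _]gE; exact: E.
have Es := affine_chart_scale Dx Dy Ew.
have t0 : 0 <= t by rewrite divr_ge0.
have [i xi] := mincoord_min Dx; have [j yj] := mincoord_min Dy.
have [_ xim] := xi i; have [_ yjm] := yj j.
have tle : x ord0 i - c = t * (y ord0 j - c).
  apply/eqP; rewrite eq_le {2}Es; apply/andP; split.
    by rewrite -Es lerD2r (xi j).1.
  by rewrite ler_wpM2l// lerD2r (yj i).1.
have gxE : simplex_gauge x = - (m.+1%:R * (x ord0 i - c)).
  by rewrite /simplex_gauge -xim mulrBr mc; lra.
have gyE : simplex_gauge y = - (m.+1%:R * (y ord0 j - c)).
  by rewrite /simplex_gauge -yjm mulrBr mc; lra.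
have t1 : t = 1.
  apply: (mulIf gx0); rewrite mul1r {1}gE gxE gyE tle; ring.
by apply: affine_chart_inj => //; rewrite Ew t1 scale1r.
Qed.

Lemma simplex_to_ball_onto (z : 'rV[R]_m) : `|z| <= 1 -> exists2 x, simplex x & simplex_to_ball x = z.
Proof.
move=> z1.
pose e : 'rV[R]_m.+1 := \row_i (if unlift ord0 i is Some j then z ord0 j else - \sum_j z ord0 j).
have e0 : e ord0 ord0 = - \sum_j z ord0 j by rewrite mxE unlift_none.
have eS j : e ord0 (lift ord0 j) = z ord0 j by rewrite mxE liftK.
have se : \sum_i e ord0 i = 0.
  rewrite big_ord_recl/= e0; under eq_bigr do rewrite eS; by rewrite addNr.
have [/eqP z0|z0] := eqVneq z 0.
  have Db : simplex (const_mx c : 'rV[R]_m.+1).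
    split=> [i|]; first by rewrite mxE ltW.
    under eq_bigr do rewrite mxE; by rewrite sumr_const card_ord -mulr_natl.
  exists (const_mx c : 'rV[R]_m.+1) => //.
  have h : affine_chart (const_mx c) = 0 by apply/rowP => i; rewrite !mxE subrr.
  by rewrite /simplex_to_ball h scaler0 (eqP z0).
pose i0 := [arg min_(i < (ord0 : 'I_m.+1)) e ord0 i]%O.
have i0P j : e ord0 i0 <= e ord0 j.
  by rewrite /i0; case: arg_minP => //= i _; exact.
set mu := - e ord0 i0.
have mu0 : 0 < mu.
  rewrite oppr_gt0 ltNge; apply/negP => ge0.
  move/eqP: z0; apply; apply/rowP => j; rewrite mxE -eS; apply/eqP.
  have h : forall i, 0 <= e ord0 i by move=> i; exact: le_trans (i0P i).
  move/eqP: se; rewrite psumr_eq0// => /allP; apply; exact: mem_index_enum.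
(* The least entry of [e] is [- mu], so the point at parameter [t] on the ray has gauge
   [m.+1 * t * mu]; this is set equal to the norm of [z]. *)
pose t := `|z| / (m.+1%:R * mu).
have m1 : 0 < m.+1%:R :> R by rewrite ltr0n.
have t0 : 0 < t by rewrite divr_gt0 ?normr_gt0// mulr_gt0.
have tE : t * mu = `|z| * c.
  by rewrite /t /c; field; rewrite (gt_eqF mu0) addrC natr1 (gt_eqF m1).
pose x : 'rV[R]_m.+1 := \row_i (c + t * e ord0 i).
have xE i : x ord0 i = c + t * e ord0 i by rewrite mxE.
have xmin i : c - t * mu <= x ord0 i.
  by rewrite xE lerD2l /mu mulrN opprK ler_pM2l.
have Dx : simplex x.
  split=> [i|].
    apply: le_trans (xmin i); rewrite tE subr_ge0 ger_pMl//.
  under eq_bigr do rewrite xE.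
  by rewrite big_split/= -mulr_sumr se mulr0 addr0 sumr_const card_ord -mulr_natl.
have wE : affine_chart x = t *: z.
  by apply/rowP => j; rewrite mxE xE eS !mxE; ring.
have gE : simplex_gauge x = `|z|.
  have [i xi] := mincoord_min Dx; have [_ xim] := xi i.
  have xii : x ord0 i = c - t * mu.
    apply/eqP; rewrite eq_le xmin andbT; apply: le_trans (xi i0).1 _.
    by rewrite xE /mu mulrN opprK.
  by rewrite /simplex_gauge -xim xii tE mulrBr mulrCA mc; ring.
exists x => //; rewrite /simplex_to_ball wE gE normrZ (gtr0_norm t0) scalerA.
have -> : `|z| / (t * `|z|) * t = 1; last by rewrite scale1r.
by field; rewrite normr_eq0 z0 gt_eqF.
Qed.
End SimplexToBall.

(** * Parametrizing the ball simplex by simplex *)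

Section BallParam.
Local Open Scope ring_scope.
Local Open Scope classical_set_scope.
Variables (R : realType) (m : nat).
Let d := m.+1.
Variables (C : nat -> {set 'I_d}) (p : nat -> 'I_d -> nat)
  (rep : nat -> {set 'I_d} -> nat) (M : nat).
Hypothesis sh : shelling C p rep M.
Implicit Types x y : 'rV[R]_d.

Definition boundary_point N k x : Prop :=
  exists l u, [/\ free_facet C p N l u, u \notin supp x & rep l (supp x) = rep k (supp x)].

(** By [ball_inj] the maps overlap exactly in the identifications of the complex. [ball_boundary]
    keeps the induction going: the free facets fill the unit sphere, where the next simplex is
    attached. *)
Record ball_param (N : nat) (Phi : nat -> 'rV[R]_d -> 'rV[R]_m) : Prop := BallParam {
  ball_continuous : forall k, (k < N)%N -> {within simplex (d := d), continuous (Phi k)};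
  ball_inj : forall k l x y, (k < N)%N -> (l < N)%N -> simplex x -> simplex y ->
    (Phi k x = Phi l y <-> x = y /\ rep k (supp x) = rep l (supp x));
  ball_onto : forall z, `|z| <= 1 -> exists k x, [/\ (k < N)%N, simplex x & Phi k x = z];
  ball_norm : forall k x, (k < N)%N -> simplex x -> `|Phi k x| <= 1;
  ball_boundary : forall k x, (k < N)%N -> simplex x ->
    (`|Phi k x| = 1 <-> boundary_point N k x) }.

Lemma notin_supp x i : simplex x -> (i \notin supp x) = (x ord0 i == 0).
Proof. by move=> Dx; rewrite inE -leNgt eq_le Dx.1 andbT. Qed.

Lemma ball_param1 : (0 < M)%N -> exists Phi, ball_param 1 Phi.
Proof.
move=> M0; exists (fun=> @simplex_to_ball R m); split => //.
- by move=> k _; exact: simplex_to_ball_continuous.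
- move=> [|//] [|//] x y _ _ Dx Dy; split => [/(simplex_to_ball_inj Dx Dy) ->|[-> _]] //.
- by move=> z /simplex_to_ball_onto[x Dx <-]; exists 0%N, x.
- by move=> k x _ Dx; rewrite norm_simplex_to_ball// simplex_gauge_le1.
- move=> [|//] x _ Dx; rewrite norm_simplex_to_ball//.
  apply: iff_trans (simplex_gauge_eq1 Dx) _; split => [[u xu]|[l [u [_ uS _]]]].
    exists 0%N, u; split => //; last by rewrite notin_supp// xu.
    rewrite /free_facet (shelling_C0 sh M0) inE; split => // -[|//] _.
    by rewrite (shelling_C0 sh M0) inE.
  by exists u; apply/eqP; rewrite -notin_supp.
Qed.

Section Step.
Variables (N : nat) (Phi : nat -> 'rV[R]_d -> 'rV[R]_m).
Hypotheses (N0 : (0 < N)%N) (NM : (N < M)%N) (bp : ball_param N Phi).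

Let A := ~: C N.
Let CN0 : C N != finset.set0. Proof. by apply: (shelling_neq0 sh); rewrite N0. Qed.
Let A0 : A != finset.set0.
Proof. by rewrite /A -finset.setCT (inj_eq (can_inj (@finset.setCK _))) (shelling_neqT sh NM). Qed.

(* The height of the lens over a boundary point; it vanishes off the attaching region and on
   its relative boundary. *)
Definition in_attaching k x := ~~ (C N \subset supp x) && (rep k (supp x) == rep N (supp x)).
Definition attaching_height k x : R := if in_attaching k x then mincoord A x else 0.
Definition preim_param (z : 'rV[R]_m) : nat * 'rV[R]_d :=
  xget (0%N, 0) [set kx | [/\ (kx.1 < N)%N, simplex kx.2 & Phi kx.1 kx.2 = z]].
Definition height (z : 'rV[R]_m) : R := attaching_height (preim_param z).1 (preim_param z).2.

(** The preimage chosen is irrelevant: any two share the point [x], and the index enters only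
    through [rep k (supp x)]. *)
Lemma heightE k x : (k < N)%N -> simplex x -> height (Phi k x) = attaching_height k x.
Proof.
move=> kN Dx; rewrite /height /preim_param; case: xgetP => [[l y] _ /= [lN Dy E]|/(_ (k, x))[]//].
have [-> r] := (ball_inj bp lN kN Dy Dx).1 E.
by rewrite /attaching_height /in_attaching r.
Qed.

Lemma attaching_height_ge0 k x : simplex x -> 0 <= attaching_height k x.
Proof. by move=> Dx; rewrite /attaching_height; case: ifP => // _; exact: mincoord_ge0. Qed.

Lemma attaching_height_le1 k x : simplex x -> attaching_height k x <= 1.
Proof.
by move=> Dx; rewrite /attaching_height; case: ifP => // _; exact: bigmin_le_id.
Qed.

Lemma height_bounds z : `|z| <= 1 -> 0 <= height z <= 1.
Proof.
move=> /(ball_onto bp)[k [x [kN Dx <-]]]; rewrite heightE//.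
by rewrite attaching_height_ge0// attaching_height_le1.
Qed.

Lemma mincoord_eq0 (B : {set 'I_d}) x : simplex x -> B != finset.set0 ->
  (mincoord B x == 0) = ~~ (B \subset supp x).
Proof.
move=> Dx B0; apply/idP/idP.
  move=> /eqP E; have [i iB xi] := mincoord_attained Dx B0.
  by apply/subsetPn; exists i => //; rewrite notin_supp// xi E.
move=> /subsetPn[i iB]; rewrite notin_supp// => /eqP xi.
by rewrite eq_le mincoord_ge0// andbT -xi mincoord_le.
Qed.

(** This is where [shelling_frontier] enters: a positive minimum over [A] puts all of [A] in the
    support, so the facet must be a glued one. On each free facet the height is thus given by one
    continuous formula. *)
Lemma attaching_height_facet l u x : free_facet C p N l u -> simplex x -> u \notin supp x ->
  attaching_height l x = if (u \in C N) && (p N u == l) then mincoord A x else 0.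
Proof.
move=> fr Dx uS; rewrite /attaching_height.
have [/andP[uC /eqP pu]|nu] := boolP ((u \in C N) && (p N u == l)).
  rewrite /in_attaching -pu (shelling_old sh NM uC uS) eqxx andbT.
  by rewrite ifT//; apply/subsetPn; exists u.
case: ifPn => // /andP[_ /eqP rl]; apply/eqP; rewrite mincoord_eq0//.
apply/negP => AS; have uC : u \in C N.
  by apply/negPn/negP => uA; move/negP: uS; apply; apply: (fintype.subsetP AS); rewrite inE.
by move/negP: nu; apply; rewrite uC eq_sym; apply/eqP/(shelling_frontier sh NM fr uC uS AS).
Qed.

Lemma height_continuous : {within [set z | `|z| = 1], continuous height}.
Proof.
pose X (lu : 'I_N * 'I_d) : set 'rV[R]_d :=
  [set x | free_facet C p N lu.1 lu.2 /\ simplex x /\ x ord0 lu.2 = 0].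
have Xsub lu : X lu `<=` simplex (d := d) by move=> x [_ []].
apply: (@within_continuous_quotient R _ _ R^o ('I_N * 'I_d)%type X (fun lu => Phi lu.1)).
- move=> [l u]; have [fr|nfr] := pselect (free_facet C p N l u); last first.
    by rewrite (_ : X _ = set0); [exact: compact0|apply/seteqP; split => x // []].
  rewrite (_ : X _ = simplex (d := d) `&` [set x : 'rV[R]_d | x ord0 u = 0]); last first.
    by apply/seteqP; split => x [] // ? []; split.
  apply: compact_closedI; first exact: simplex_compact.
  by apply: (closed_comp (f := fun x : 'rV[R]_d => x ord0 u)) (@closed_eq R 0) => x _;
    exact: coord_continuous.
- by move=> [l u]; apply: continuous_subspaceW (ball_continuous bp (ltn_ord l)); exact: Xsub.
- move=> [l u]; apply: (@subspace_eq_continuous _ _ R^o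
    (fun x => if (u \in C N) && (p N u == l) then mincoord A x else 0)).
    move=> x; rewrite inE => -[/= fr [Dx xu]]; 
    suff : (if (u \in C N) && (p N u == l) then mincoord A x else 0) = height (Phi l x) by [].
    rewrite heightE//.
    by rewrite (attaching_height_facet fr)// notin_supp// xu.
  apply: continuous_subspaceT => x.
  case: (_ && _); [exact: mincoord_continuous|exact: (@cst_continuous _ R^o 0)].
- move=> z /= z1; have /(ball_onto bp)[k [x [kN Dx E]]] : `|z| <= 1 by rewrite z1.
  have /(ball_boundary bp kN Dx)[l [u [fr uS r]]] : `|Phi k x| = 1 by rewrite E.
  have lN : (l < N)%N by case: fr.
  exists (Ordinal lN, u); exists x => /=.
    by split => //; split => //; apply/eqP; rewrite -notin_supp.
  by rewrite -E; apply/(ball_inj bp).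
Qed.

(** Heights are at most 1, so halving them keeps the factor at least 1/2. At [z = 0] the direction
    degenerates to 0, still a point of the ball, so the bounds persist. *)
Definition squeeze (z : 'rV[R]_m) : 'rV[R]_m := (1 - height (`|z|^-1 *: z) / 2) *: z.

Lemma norm_dir (z : 'rV[R]_m) : z != 0 -> `| `|z|^-1 *: z| = 1.
Proof. by move=> z0; rewrite normrZ normfV normr_id mulVf// normr_eq0. Qed.

Lemma squeeze_factor (z : 'rV[R]_m) :
  1 / 2 <= 1 - height (`|z|^-1 *: z) / 2 <= 1.
Proof.
have : 0 <= height (`|z|^-1 *: z) <= 1.
  apply: height_bounds; have [->|z0] := eqVneq z 0; last by rewrite norm_dir.
  by rewrite scaler0 normr0.
lra.
Qed.

Lemma norm_squeeze z : `|squeeze z| = (1 - height (`|z|^-1 *: z) / 2) * `|z|.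
Proof. by rewrite /squeeze normrZ ger0_norm//; have := squeeze_factor z; lra. Qed.

Lemma norm_squeeze_le z : `|squeeze z| <= `|z|.
Proof.
by rewrite norm_squeeze ler_piMl//; have := squeeze_factor z; lra.
Qed.

Lemma squeeze_continuous : {within [set z | `|z| <= 1], continuous squeeze}.
Proof.
apply/subspace_continuousP => z z1.
have [z0|z0] := eqVneq z 0.
  have s0 : squeeze z = 0 by rewrite /squeeze z0 scaler0.
  apply/cvgrPdist_lt => e e0; rewrite near_withinE.
  near=> y => Dy.
  suff : `|squeeze z - squeeze y| < e by [].
  rewrite s0 sub0r normrN; apply: le_lt_trans (norm_squeeze_le _) _.
  have : `|z - y| < e by near: y; apply: (@cvgr_dist_lt _ _ _ (nbhs z) _ id z).
  by rewrite z0 sub0r normrN.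
apply: cvg_within_filter; apply: (@cvgZ R _ _ (nbhs z)); last exact: cvg_id.
apply: (@cvgB R R^o _ (nbhs z) _ (fun=> 1)); first exact: cvg_cst.
apply: (@cvgM R _ (nbhs z) _ _ (fun=> 2^-1)); last exact: cvg_cst.
have cd : (fun z : 'rV[R]_m => `|z|^-1 *: z) @ nbhs z --> `|z|^-1 *: z.
  apply: (@cvgZ R _ _ (nbhs z)); last exact: cvg_id.
  by apply: cvgV; [rewrite normr_eq0|apply: cvg_norm; exact: cvg_id].
apply/(@cvgrPdist_lt R R^o) => e e0.
have /subspace_continuousP/(_ _ (norm_dir z0))/cvgrPdist_lt/(_ e e0) := height_continuous.
rewrite near_withinE => H.
near=> y.
have : `| `|y|^-1 *: y| = 1 -> `|height (`|z|^-1 *: z) - height (`|y|^-1 *: y)| < e.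
  by near: y; exact: (cd _ H).
apply; apply: norm_dir.
have : `|z - y| < `|z| by near: y; apply: (@cvgr_dist_lt _ _ _ (nbhs z) _ id z); rewrite ?normr_gt0.
by apply: contraTneq => ->; rewrite subr0 ltxx.
Unshelve. all: by end_near. Qed.

Lemma scale_dir (t : R) (z : 'rV[R]_m) : 0 < t -> `|t *: z|^-1 *: (t *: z) = `|z|^-1 *: z.
Proof.
move=> t0; rewrite normrZ gtr0_norm// scalerA; have [->|z0] := eqVneq z 0.
  by rewrite !scaler0.
by congr (_ *: _); field; rewrite normr_eq0 z0 gt_eqF.
Qed.

Lemma squeeze_dir z : `|squeeze z|^-1 *: squeeze z = `|z|^-1 *: z.
Proof. by rewrite /squeeze scale_dir//; have := squeeze_factor z; lra. Qed.

Lemma squeeze_inj : injective squeeze.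
Proof.
move=> z y E.
have D : `|z|^-1 *: z = `|y|^-1 *: y by rewrite -[LHS]squeeze_dir E squeeze_dir.
move: E; rewrite /squeeze -D; apply: scalerI.
by have := squeeze_factor z; lra.
Qed.

Lemma squeeze_onto z : `|z| <= 1 - height (`|z|^-1 *: z) / 2 ->
  exists2 y, `|y| <= 1 & squeeze y = z.
Proof.
set t := (X in _ <= X) => zt; have t0 : 0 < t by have := squeeze_factor z; rewrite /t; lra.
exists (t^-1 *: z).
  by rewrite normrZ normfV gtr0_norm// ler_pdivrMl// mulr1.
by rewrite /squeeze scale_dir ?invr_gt0// scalerA mulfV ?scale1r// gt_eqF.
Qed.

(** The rate that gives [dir] coordinate sum 0. *)
Let kappa : R := #|C N|%:R / #|A|%:R.
Let cardA : (0 : R) < #|A|%:R. Proof. by rewrite ltr0n card_gt0. Qed.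
Let kappa0 : 0 < kappa.
Proof. by rewrite divr_gt0// ltr0n card_gt0. Qed.

(* The lines in this direction sweep out the simplex from its facets opposite to
   the vertices of [C N] to the other facets. *)
Let dir : 'rV[R]_d := \row_i (if i \in C N then -1 else kappa).

Definition base_point x : 'rV[R]_d := x + mincoord (C N) x *: dir.

Lemma sum_dir : \sum_i dir ord0 i = 0.
Proof.
under eq_bigr do rewrite mxE.
rewrite (bigID (mem (C N)))/=.
under eq_bigr => i iC do rewrite iC.
rewrite sumr_const.
under eq_bigr => i iC do rewrite (negPf iC).
rewrite (eq_bigl (mem A)) ?sumr_const; last by move=> i; rewrite !inE.
rewrite -[kappa *+ _]mulr_natr /kappa divfK ?gt_eqF//.
by rewrite mulNrn addNr.
Qed.

Lemma simplex_shift x t : simplex x ->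
  (forall i, i \in C N -> t <= x ord0 i) ->
  (forall i, i \in A -> 0 <= x ord0 i + t * kappa) -> simplex (x + t *: dir).
Proof.
move=> Dx hC hA; split => [i|].
  rewrite !mxE; case: ifPn => iC; first by rewrite mulrN1 subr_ge0 hC.
  by rewrite hA// inE.
under eq_bigr => i _. rewrite mxE [X in _ + X]mxE; over.
by rewrite big_split/= Dx.2 -mulr_sumr sum_dir mulr0 addr0.
Qed.

Lemma base_point_simplex x : simplex x -> simplex (base_point x).
Proof.
move=> Dx; apply: simplex_shift => // [i iC|i iA]; first exact: mincoord_le.
by rewrite addr_ge0 ?(Dx.1)// mulr_ge0 ?(ltW kappa0)// mincoord_ge0.
Qed.

Lemma base_pointC x i : i \in C N -> base_point x ord0 i = x ord0 i - mincoord (C N) x.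
Proof. by move=> iC; rewrite !mxE iC mulrN1. Qed.

Lemma base_pointA x i : i \in A -> base_point x ord0 i = x ord0 i + mincoord (C N) x * kappa.
Proof. by rewrite inE => iC; rewrite !mxE (negPf iC). Qed.

Lemma mincoordA_base_point x : simplex x ->
  mincoord A (base_point x) = mincoord A x + mincoord (C N) x * kappa.
Proof.
move=> Dx; have Db := base_point_simplex Dx.
have [i iA xi] := mincoord_attained Dx A0; have [j jA bj] := mincoord_attained Db A0.
apply/eqP; rewrite eq_le; apply/andP; split.
  by rewrite -xi -base_pointA// mincoord_le.
by rewrite -bj base_pointA// lerD2r mincoord_le.
Qed.

Definition attaching_vertex x : 'I_d := odflt ord0 [pick v in C N | x ord0 v == mincoord (C N) x].

Lemma attaching_vertexP x : simplex x ->
  attaching_vertex x \in C N /\ x ord0 (attaching_vertex x) = mincoord (C N) x.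
Proof.
move=> Dx; rewrite /attaching_vertex; case: pickP => [v /andP[vC /eqP xv]|/= h]; first by [].
have [i iC xi] := mincoord_attained Dx CN0.
by have := h i; rewrite iC xi eqxx.
Qed.

(** On the line over a base point [y] the radius grows from [1 - mincoord A y / 2], on the squeezed
    sphere, to 1, where [mincoord A] vanishes; the simplex fills the gap in between. *)
Definition new_param x : 'rV[R]_m :=
  (1 - mincoord A x / 2) *: Phi (p N (attaching_vertex x)) (base_point x).

Lemma PhiN_vertex y v w : simplex y -> v \in C N -> w \in C N -> y ord0 v = 0 -> y ord0 w = 0 ->
  Phi (p N v) y = Phi (p N w) y.
Proof.
move=> Dy vC wC yv yw; apply/(ball_inj bp) => //; [exact: (parent_lt sh)|exact: (parent_lt sh)|].
split => //; rewrite -(shelling_old sh NM vC) ?notin_supp ?yv//.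
by rewrite (shelling_old sh NM wC) ?notin_supp ?yw.
Qed.

Lemma new_paramE x v : simplex x -> v \in C N -> x ord0 v = mincoord (C N) x ->
  new_param x = (1 - mincoord A x / 2) *: Phi (p N v) (base_point x).
Proof.
move=> Dx vC xv; have [wC xw] := attaching_vertexP Dx.
congr (_ *: _); apply: PhiN_vertex => //; first exact: base_point_simplex.
  by rewrite base_pointC// xw subrr.
by rewrite base_pointC// xv subrr.
Qed.

Lemma norm_PhiN y v : simplex y -> v \in C N -> y ord0 v = 0 -> `|Phi (p N v) y| = 1.
Proof.
move=> Dy vC yv; apply/(ball_boundary bp) => //; first exact: (parent_lt sh).
by exists (p N v), v; split => //; [exact: (shelling_free sh)|rewrite notin_supp ?yv].
Qed.

Lemma height_PhiN y v : simplex y -> v \in C N -> y ord0 v = 0 ->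
  height (Phi (p N v) y) = mincoord A y.
Proof.
move=> Dy vC yv; rewrite heightE//; last exact: (parent_lt sh).
rewrite (attaching_height_facet (shelling_free sh NM vC))// ?vC ?eqxx//.
by rewrite notin_supp ?yv.
Qed.

Definition step_param k : 'rV[R]_d -> 'rV[R]_m :=
  if k == N then new_param else squeeze \o Phi k.

Lemma step_param_old k : (k < N)%N -> step_param k = squeeze \o Phi k.
Proof. by move=> kN; rewrite /step_param ltn_eqF. Qed.

Lemma step_param_new : step_param N = new_param.
Proof. by rewrite /step_param eqxx. Qed.

Lemma base_point_continuous : continuous base_point.
Proof.
move=> x; apply: (@cvgD R _ _ (nbhs x)); first exact: cvg_id.
by apply: (@cvgZ R _ _ (nbhs x)); [exact: mincoord_continuous|exact: cvg_cst].
Qed.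

Lemma new_param_continuous : {within simplex (d := d), continuous new_param}.
Proof.
pose X (v : 'I_d) : set 'rV[R]_d :=
  [set x | [/\ v \in C N, simplex x & x ord0 v - mincoord (C N) x = 0]].
apply: (@within_continuous_quotient R _ _ _ 'I_d X (fun _ => id)).
- move=> v; have [vC|vC] := boolP (v \in C N); last first.
    by rewrite (_ : X _ = set0); [exact: compact0|apply/seteqP; split => x // [h]; rewrite h in vC].
  rewrite (_ : X _ = simplex (d := d) `&` [set x : 'rV[R]_d | x ord0 v - mincoord (C N) x = 0]); last first.
    by apply/seteqP; split => x [] // ? ?; split.
  apply: compact_closedI; first exact: simplex_compact.
  apply: (closed_comp (f := fun x : 'rV[R]_d => x ord0 v - mincoord (C N) x)) (@closed_eq R 0) => x _.
  by apply: (@cvgB R R^o _ (nbhs x)); [exact: coord_continuous|exact: mincoord_continuous].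
- by move=> v; apply: continuous_subspaceT => x; exact: cvg_id.
- move=> v; have [vC|vC] := boolP (v \in C N); last first.
    by rewrite (_ : X _ = set0); [exact: continuous_subspace0|apply/seteqP; split => x // [h]; rewrite h in vC].
  apply: (@subspace_eq_continuous _ _ _
    (fun x => (1 - mincoord A x / 2) *: Phi (p N v) (base_point x))).
    move=> x; rewrite inE => -[_ Dx xv].
    suff : (1 - mincoord A x / 2) *: Phi (p N v) (base_point x) = new_param x by [].
    by rewrite (@new_paramE _ v)//; move/eqP: xv; rewrite subr_eq0 => /eqP.
  have XD : X v `<=` simplex (d := d) by move=> x [].
  apply: (continuous_subspaceW XD); apply/subspace_continuousP => x Dx.
  apply: cvgZ.
    apply: cvg_within_filter.
    apply: (@cvgB R R^o _ (nbhs x) _ (fun=> 1)); first exact: cvg_cst.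
    by apply: (@cvgM R _ (nbhs x) _ _ (fun=> 2^-1)); [exact: mincoord_continuous|exact: cvg_cst].
  have : {within simplex (d := d), continuous (Phi (p N v) \o base_point)}.
    apply: (comp_within_continuous base_point_simplex).
      by apply: continuous_subspaceT; exact: base_point_continuous.
    by apply: (ball_continuous bp); exact: (parent_lt sh).
  by move=> /subspace_continuousP; exact.
- move=> x Dx; have [vC xv] := attaching_vertexP Dx.
  by exists (attaching_vertex x); exists x => //; split => //; rewrite xv subrr.
Qed.

Let AS x : simplex x -> mincoord A x != 0 -> A \subset supp x.
Proof. by move=> Dx; rewrite mincoord_eq0// negbK. Qed.

Lemma notin_A u x : simplex x -> mincoord A x != 0 -> u \notin supp x -> u \in C N.
Proof.
move=> Dx /(AS Dx) AsubS uS; apply/negPn/negP => uC.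
by move/negP: uS; apply; apply: (fintype.subsetP AsubS); rewrite inE.
Qed.

Lemma new_param_spec x : simplex x -> exists v, [/\ v \in C N,
  base_point x ord0 v = 0 & new_param x = (1 - mincoord A x / 2) *: Phi (p N v) (base_point x)].
Proof.
move=> Dx; have [vC xv] := attaching_vertexP Dx; exists (attaching_vertex x).
by split => //; rewrite base_pointC// xv subrr.
Qed.

Lemma mincoordA_bounds x : simplex x -> 0 <= mincoord A x <= 1.
Proof. by move=> Dx; rewrite mincoord_ge0//; exact: bigmin_le_id. Qed.

Lemma norm_new_param x : simplex x -> `|new_param x| = 1 - mincoord A x / 2.
Proof.
move=> Dx; have [v [vC bv ->]] := new_param_spec Dx.
rewrite normrZ norm_PhiN// ?mulr1; last exact: base_point_simplex.
by rewrite ger0_norm//; have := mincoordA_bounds Dx; lra.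
Qed.

Lemma new_param_dir x v : simplex x -> v \in C N -> base_point x ord0 v = 0 ->
  `|new_param x|^-1 *: new_param x = Phi (p N v) (base_point x).
Proof.
move=> Dx vC bv; have Db := base_point_simplex Dx.
have [w [wC bw ->]] := new_param_spec Dx.
rewrite scale_dir; last by have := mincoordA_bounds Dx; lra.
by rewrite norm_PhiN// invr1 scale1r; exact: PhiN_vertex.
Qed.

Lemma base_point_eq x : mincoord (C N) x = 0 -> base_point x = x.
Proof. by move=> E; rewrite /base_point E scale0r addr0. Qed.

(** The norm recovers [mincoord A x] and the direction recovers the base point; by
    [mincoordA_base_point] the two fix the position on the line. *)
Lemma new_param_inj x y : simplex x -> simplex y -> new_param x = new_param y -> x = y.
Proof.
move=> Dx Dy E; have [v [vC bv _]] := new_param_spec Dx.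
have [w [wC bw _]] := new_param_spec Dy.
have mE : mincoord A x = mincoord A y.
  by have := norm_new_param Dx; rewrite E norm_new_param//; lra.
have : Phi (p N v) (base_point x) = Phi (p N w) (base_point y).
  by rewrite -!new_param_dir// E.
have pv := parent_lt sh NM vC; have pw := parent_lt sh NM wC.
move=> /(ball_inj bp pv pw (base_point_simplex Dx) (base_point_simplex Dy))[bE _].
have := mincoordA_base_point Dx; rewrite bE mincoordA_base_point// mE => h.
have {h} cE : mincoord (C N) x = mincoord (C N) y.
  apply: (@mulIf _ kappa); first by rewrite gt_eqF.
  lra.
by move: bE; rewrite /base_point cE => /addIr.
Qed.

(** In the direction of [new_param x] the squeezed ball ends at radius [1 - (mincoord A x + mincoord
    (C N) x * kappa) / 2], while [new_param x] has radius [1 - mincoord A x / 2]. Equality forces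
    [mincoord (C N) x = 0], so [x] is its own base point, and puts [Phi k y] on the unit sphere. *)
Lemma new_param_old x k y : (k < N)%N -> simplex x -> simplex y ->
  (new_param x = squeeze (Phi k y)) <-> (x = y /\ rep N (supp x) = rep k (supp x)).
Proof.
move=> kN Dx Dy; have [v [vC bv nE]] := new_param_spec Dx; have pv := parent_lt sh NM vC.
have Db := base_point_simplex Dx; split => [E|[E r]].
  have dE : `|Phi k y|^-1 *: Phi k y = Phi (p N v) (base_point x).
    by rewrite -squeeze_dir -E (new_param_dir Dx vC bv).
  have : `|squeeze (Phi k y)| = 1 - mincoord A x / 2 by rewrite -E norm_new_param.
  rewrite norm_squeeze dE height_PhiN// mincoordA_base_point// => nrm.
  have z1 := ball_norm bp kN Dy.
  have mc0 := mincoord_ge0 (C N) Dx.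
  have kc0 : 0 <= mincoord (C N) x * kappa by rewrite mulr_ge0// ltW.
  have := squeeze_factor (Phi k y); rewrite dE height_PhiN// mincoordA_base_point// => sf.
  have : (1 - (mincoord A x + mincoord (C N) x * kappa) / 2) * `|Phi k y| <=
      1 - (mincoord A x + mincoord (C N) x * kappa) / 2 by rewrite ler_piMr//; lra.
  rewrite nrm => le1.
  have /eqP : mincoord (C N) x * kappa = 0 by lra.
  rewrite mulf_eq0 (gt_eqF kappa0) orbF => /eqP c0.
  move: nrm; rewrite c0 mul0r addr0 => nrm.
  have z1' : `|Phi k y| = 1.
    apply: (@mulfI _ (1 - mincoord A x / 2)); last by rewrite mulr1.
    by rewrite gt_eqF//; have := mincoordA_bounds Dx; lra.
  move: dE; rewrite z1' invr1 scale1r base_point_eq// => /(ball_inj bp kN pv Dy Dx)[yx rk].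
  split; first by [].
  by rewrite -yx rk yx (shelling_old sh NM vC) ?notin_supp// -(base_point_eq c0) bv.
have nCS : ~~ (C N \subset supp x).
  apply/negP => CS; move: r; rewrite (shelling_new sh NM CS) => rN.
  by have := rep_le sh (supp x) (ltn_trans kN NM); rewrite -rN leqNgt kN.
have c0 : mincoord (C N) x = 0 by apply/eqP; rewrite mincoord_eq0.
move: bv Db nE; rewrite base_point_eq// => bv _ ->.
have -> : Phi k y = Phi (p N v) x.
  apply/(ball_inj bp) => //; rewrite -E; split => //.
  by rewrite -r (shelling_old sh NM vC)// notin_supp ?bv.
by rewrite /squeeze norm_PhiN// invr1 scale1r height_PhiN.
Qed.

Lemma step_param_onto z : `|z| <= 1 ->
  exists k x, [/\ (k < N.+1)%N, simplex x & step_param k x = z].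
Proof.
move=> z1; have [hz|hz] := leP `|z| (1 - height (`|z|^-1 *: z) / 2).
  have [y y1 <-] := squeeze_onto hz; have [k [x [kN Dx <-]]] := ball_onto bp y1.
  by exists k, x; rewrite step_param_old// (ltn_trans kN).
have z0 : z != 0.
  apply: contraTneq hz => ->; rewrite normr0 -leNgt.
  by have := squeeze_factor 0; rewrite normr0; lra.
set u := `|z|^-1 *: z in hz.
have u1 : `|u| = 1 by exact: norm_dir.
have /(ball_onto bp)[k [y [kN Dy E]]] : `|u| <= 1 by rewrite u1.
have : height u != 0 by apply: contraTneq hz => ->; rewrite -leNgt; lra.
rewrite -E heightE// /attaching_height; case: ifPn => [/andP[nCS /eqP r]|]; last by rewrite eqxx.
move=> hy0; have /subsetPn[v vC vS] := nCS.
have yv : y ord0 v = 0 by apply/eqP; rewrite -notin_supp.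
have uE : u = Phi (p N v) y.
  rewrite -E; apply/(ball_inj bp) => //; first exact: (parent_lt sh).
  by rewrite r (shelling_old sh NM vC).
have hE : height u = mincoord A y by rewrite uE height_PhiN.
(* [a] is the value of [mincoord A] that the norm of [z] prescribes; moving back from [y] by [t]
   against [dir] lowers [mincoord A] to it. *)
pose a := 2 * (1 - `|z|); pose t := (mincoord A y - a) / kappa.
have a0 : 0 <= a by rewrite /a; lra.
have ay : a < mincoord A y by rewrite /a -hE; lra.
have tk : t * kappa = mincoord A y - a by rewrite /t divfK// gt_eqF.
have t0 : 0 < t by rewrite divr_gt0//; lra.
pose x := y + (- t) *: dir.
have xC i : i \in C N -> x ord0 i = y ord0 i + t by move=> iC; rewrite !mxE iC mulrN1 opprK.
have xA i : i \in A -> x ord0 i = y ord0 i - t * kappa.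
  by rewrite inE => iC; rewrite !mxE (negPf iC) mulNr.
have Dx : simplex x.
  apply: simplex_shift => // i iX; first by have := Dy.1 i; lra.
  by rewrite mulNr tk; have := mincoord_le y iX; lra.
have cx : mincoord (C N) x = t.
  have [i iC xi] := mincoord_attained Dx CN0; apply/eqP; rewrite eq_le; apply/andP; split.
    by have := mincoord_le x vC; rewrite xC// yv add0r.
  by rewrite -xi xC//; have := Dy.1 i; lra.
have bx : base_point x = y by rewrite /base_point cx /x scaleNr subrK.
have ax : mincoord A x = a.
  by have := mincoordA_base_point Dx; rewrite bx cx tk; lra.
exists N, x; split => //; rewrite step_param_new.
rewrite (@new_paramE _ v)//; last by rewrite xC// yv add0r cx.
rewrite bx -uE ax /a /u scalerA.
have -> : (1 - 2 * (1 - `|z|) / 2) / `|z| = 1 by field; rewrite normr_eq0.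
by rewrite scale1r.
Qed.

Lemma step_boundary_new x : simplex x -> `|new_param x| = 1 <-> boundary_point N.+1 N x.
Proof.
move=> Dx; rewrite norm_new_param//; split => [h|[l [u [fr uS r]]]].
  have a0 : mincoord A x == 0 by apply/eqP; lra.
  move: a0; rewrite mincoord_eq0// => /subsetPn[u uA uS].
  exists N, u; split => //; apply/(free_facetS sh _ _ NM); left; split => //.
  by rewrite inE in uA.
have [->|a0] := eqVneq (mincoord A x) 0; first by rewrite mul0r subr0.
have uC := notin_A Dx a0 uS.
move: fr => /(free_facetS sh _ _ NM)[[_]|[fr nl]]; first by rewrite uC.
by case: nl; split => //; symmetry; exact: (shelling_frontier sh NM fr uC uS (AS Dx a0) r).
Qed.

(** A point stays on the sphere when it was there with height 0. If its free facet is not glued,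
    that facet survives. If it is glued, height 0 means that some vertex [w] outside [C N] is
    missing, and the facet of the new simplex opposite to [w] takes over. *)
Lemma step_boundary_old k x : (k < N)%N -> simplex x ->
  `|squeeze (Phi k x)| = 1 <-> boundary_point N.+1 k x.
Proof.
move=> kN Dx.
have -> : `|squeeze (Phi k x)| = 1 <-> (`|Phi k x| = 1 /\ attaching_height k x = 0).
  have z1 := ball_norm bp kN Dx; have sf := squeeze_factor (Phi k x).
  split=> [h|[h1 h2]]; last first.
    by rewrite norm_squeeze h1 invr1 scale1r heightE// h2; lra.
  have nz : `|Phi k x| = 1.
    apply/eqP; rewrite eq_le z1 -h; exact: norm_squeeze_le.
  split => //; move: h; rewrite norm_squeeze nz invr1 scale1r heightE//; lra.
split => [[/(ball_boundary bp kN Dx)[l [u [fr uS r]]] h0]|[l [u [fr uS r]]]].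
  have [/andP[uC /eqP pu]|nl] := boolP ((u \in C N) && (p N u == l)); last first.
    exists l, u; split => //; apply/(free_facetS sh _ _ NM); right; split => //.
    by move=> [uC pu]; move/negP: nl; apply; rewrite uC pu eqxx.
  have rN : rep N (supp x) = rep k (supp x) by rewrite (shelling_old sh NM uC uS) pu.
  move: h0; rewrite /attaching_height /in_attaching rN eqxx andbT ifT; last first.
    by apply/subsetPn; exists u.
  move=> /eqP; rewrite mincoord_eq0// => /subsetPn[w wA wS].
  exists N, w; split => //; apply/(free_facetS sh _ _ NM); left; split => //.
  by rewrite inE in wA.
have [[lN uC]|[fr' nl]] := (free_facetS sh _ _ NM).1 fr.
  rewrite lN in r.
  have nCS : ~~ (C N \subset supp x).
    apply/negP => CS; move: r; rewrite (shelling_new sh NM CS) => rN.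
    by have := rep_le sh (supp x) (ltn_trans kN NM); rewrite -rN leqNgt kN.
  have /subsetPn[v vC vS] := nCS; split.
    apply/(ball_boundary bp) => //; exists (p N v), v; split => //; first exact: (shelling_free sh).
    by rewrite -(shelling_old sh NM vC vS).
  rewrite /attaching_height; case: ifP => // _; apply/eqP; rewrite mincoord_eq0//.
  by apply/subsetPn; exists u => //; rewrite inE.
split; first by apply/(ball_boundary bp) => //; exists l, u.
rewrite /attaching_height; case: ifP => // /andP[_ /eqP rk].
apply/eqP/negPn/negP => a0; have uC := notin_A Dx a0 uS; case: nl; split => //.
by symmetry; apply: (shelling_frontier sh NM fr' uC uS (AS Dx a0)); rewrite r.
Qed.

Lemma ball_paramS : ball_param N.+1 step_param.
Proof.
have case_k k : (k < N.+1)%N -> k = N \/ (k < N)%N.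
  by rewrite ltnS leq_eqVlt => /predU1P.
split.
- move=> k /case_k[->|kN]; first by rewrite step_param_new; exact: new_param_continuous.
  rewrite step_param_old//; apply: comp_within_continuous (ball_continuous bp kN) squeeze_continuous.
  by move=> x Dx; exact: (ball_norm bp).
- move=> k l x y /case_k[->|kN] /case_k[->|lN] Dx Dy.
  + rewrite step_param_new; split => [/(new_param_inj Dx Dy)//|[-> _]//].
  + by rewrite step_param_new step_param_old//; exact: new_param_old.
  + rewrite step_param_new step_param_old//; split=> [/esym/(new_param_old kN Dy Dx)[-> ->]//|[E r]].
    by symmetry; apply/(new_param_old kN Dy Dx); rewrite -E.
  + rewrite !step_param_old//= -(ball_inj bp)//; split => [/squeeze_inj//|-> //].
- exact: step_param_onto.
- move=> k x /case_k[->|kN] Dx.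
    by rewrite step_param_new norm_new_param//; have := mincoordA_bounds Dx; lra.
  rewrite step_param_old//; apply: le_trans (norm_squeeze_le _) _; exact: (ball_norm bp).
- move=> k x /case_k[->|kN] Dx; first by rewrite step_param_new; exact: step_boundary_new.
  by rewrite step_param_old//; exact: step_boundary_old.
Qed.

End Step.

Lemma ball_param_exists : (0 < M)%N -> exists Phi, ball_param M Phi.
Proof.
move=> M0; suff H N : (0 < N <= M)%N -> exists Phi, ball_param N Phi by apply: H; rewrite M0/=.
elim: N => [|N IH]; first by rewrite ltnn.
move=> /= NM; case: N IH NM => [|N] IH NM; first exact: ball_param1.
by have [|Phi bp] := IH; [exact: ltnW|exists (step_param N.+1 Phi); exact: ball_paramS].
Qed.
End BallParam.

(** * The face poset and its realization *)

Section FacePoset.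
Local Open Scope ring_scope.
Variables (d : nat) (C : nat -> {set 'I_d}) (p : nat -> 'I_d -> nat)
  (rep : nat -> {set 'I_d} -> nat) (M : nat).
Hypotheses (M0 : (0 < M)%N) (sh : shelling C p rep M).

(** Each face is listed once, under the simplex in which it is new. *)
Definition face : finType := {x : 'I_M * {set 'I_d} | C x.1 \subset x.2}.
Implicit Types q r : face.
Definition face_index q : nat := (val q).1.
Definition face_set q : {set 'I_d} := (val q).2.
Definition face_le : rel face :=
  fun q r => (face_set q \subset face_set r) && (rep (face_index r) (face_set q) == face_index q).

Lemma face_index_lt q : (face_index q < M)%N. Proof. exact: ltn_ord. Qed.

Lemma rep_face_index q : rep (face_index q) (face_set q) = face_index q.
Proof. by apply: (shelling_new sh); [exact: face_index_lt|exact: (valP q)]. Qed.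

Lemma face_eq q r : face_index q = face_index r -> face_set q = face_set r -> q = r.
Proof.
move=> h1 h2; apply: val_inj; move: h1 h2; rewrite /face_index /face_set.
by case: (val q) (val r) => [a b] [a' b'] /= /val_inj -> ->.
Qed.

Lemma face_exists k S : (k < M)%N -> exists q, face_index q = rep k S /\ face_set q = S.
Proof.
move=> kM; have lt := leq_ltn_trans (rep_le sh S kM) kM.
by exists (exist _ (Ordinal lt, S) (rep_subset sh S kM)).
Qed.

Definition face0 : face := exist _ (Ordinal M0, finset.set0)
  (eq_ind_r (fun A : {set 'I_d} => A \subset finset.set0) (fintype.subxx _) (shelling_C0 sh M0)).

Definition mkface k S : face := odflt face0 [pick q : face | (face_index q == rep k S) && (face_set q == S)].

Lemma mkfaceP k S : (k < M)%N -> face_index (mkface k S) = rep k S /\ face_set (mkface k S) = S.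
Proof.
move=> kM; rewrite /mkface; case: pickP => [q /andP[/eqP ? /eqP ?]//|h].
by have [q [h1 h2]] := face_exists S kM; have := h q; rewrite h1 h2 !eqxx.
Qed.

Lemma mkface_id q : mkface (face_index q) (face_set q) = q.
Proof.
by have [h1 h2] := mkfaceP (face_set q) (face_index_lt q); apply: face_eq => //; rewrite h1 rep_face_index.
Qed.

Lemma face_le_mkface q r : face_le q r <-> (face_set q \subset face_set r /\ q = mkface (face_index r) (face_set q)).
Proof.
have [h1 h2] := mkfaceP (face_set q) (face_index_lt r).
split => [/andP[h /eqP e]|[h e]]; first by split => //; apply: face_eq; rewrite ?h1 ?h2.
by rewrite /face_le h/= {2}e h1.
Qed.

Lemma face_le_refl : reflexive face_le.
Proof. by move=> q; rewrite /face_le fintype.subxx rep_face_index eqxx. Qed.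

Lemma face_le_anti : antisymmetric face_le.
Proof.
move=> q r /andP[/andP[h1 /eqP e1] /andP[h2 /eqP e2]].
have E : face_set q = face_set r by apply/eqP; rewrite finset.eqEsubset h1.
by apply: face_eq => //; rewrite -e1 E rep_face_index.
Qed.

Lemma face_le_trans : transitive face_le.
Proof.
move=> r q s /andP[h1 /eqP e1] /andP[h2 /eqP e2].
rewrite /face_le (fintype.subset_trans h1 h2)/= -e1 -e2.
by rewrite (rep_trans sh (face_index_lt s) h1).
Qed.

Lemma face_set_eq0 q : (face_set q == finset.set0) = (q == face0).
Proof.
apply/eqP/eqP => [E|-> //]; apply: face_eq => //=; rewrite /face_index/=.
have := valP q; rewrite -/(face_set q) E finset.subset0 => C0.
apply/eqP; rewrite -leqn0 leqNgt; apply/negP => k0.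
by move: C0; apply/negP; apply: (shelling_neq0 sh); rewrite k0 ltn_ord.
Qed.

Lemma face_le0 q : face_le face0 q.
Proof.
apply/face_le_mkface; split; first exact: finset.sub0set.
have [_ h2] := mkfaceP (face_set face0) (face_index_lt q).
by symmetry; apply/eqP; rewrite -face_set_eq0 h2.
Qed.

Lemma face_le_mk k S S' : (k < M)%N -> face_le (mkface k S) (mkface k S') = (S \subset S').
Proof.
move=> kM; rewrite /face_le; have [-> ->] := mkfaceP S kM; have [-> ->] := mkfaceP S' kM.
by case: (boolP (S \subset S')) => //= SS'; rewrite (rep_trans sh kM SS') eqxx.
Qed.


Lemma face_le_mkl q S : face_le (mkface (face_index q) S) q = (S \subset face_set q).
Proof. by rewrite -{2}(mkface_id q) face_le_mk// face_index_lt. Qed.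

Lemma card_down q : #|[set r | face_le r q]%SET| = (2 ^ #|face_set q|)%N.
Proof.
rewrite -card_powerset -(card_in_imset (f := face_set)); last first.
  move=> r s; rewrite !inE => /andP[_ /eqP e1] /andP[_ /eqP e2] E.
  by apply: face_eq => //; rewrite -e1 -e2 E.
apply: eq_card => S; apply/imsetP/idP.
  by move=> [r]; rewrite inE => /andP[h _] ->; rewrite inE.
rewrite inE => SS; have [h1 h2] := mkfaceP S (face_index_lt q).
by exists (mkface (face_index q) S); rewrite ?inE ?h2// face_le_mkl.
Qed.

(** The rank is forced by counting: a Boolean interval of rank [n] has [2 ^ n] elements, and
    [card_down] counts those below [q]. Conversely, [mkface] identifies the faces below [q] with the
    subsets of its vertex set. *)
Lemma boolean_rank q n : @is_boolean_rank face face_le q n = (#|face_set q| == n).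
Proof.
apply/idP/eqP.
  move=> /existsP[f /andP[/andP[/forallP f1 /forallP f2] /forallP f3]].
  apply/eqP; rewrite -(eqn_exp2l _ _ (ltnSn 1)) -card_down.
  rewrite -[in X in _ == (2 ^ X)%N](card_ord n) -cardsT -card_powerset finset.powersetT cardsT.
  rewrite -(card_imset (f := f)) ?cardsT//.
    apply/eqP/eq_card => r; rewrite inE; apply/idP/imsetP.
      by have := f2 r => /implyP h /h /existsP[A /eqP <-]; exists A.
    by move=> [A _ ->].
  move=> A B E; apply/eqP; rewrite finset.eqEsubset.
  have /forallP h1 := f3 A; have /forallP h2 := f3 B.
  by rewrite (eqP (h1 B)) (eqP (h2 A)) E !face_le_refl.
move=> <-; pose e := @enum_val _ (mem (face_set q)).
have eS A : e @: A \subset face_set q by apply/fintype.subsetP => i /imsetP[a _ ->]; exact: enum_valP.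
apply/existsP; exists [ffun A : {set 'I_#|face_set q|} => mkface (face_index q) (e @: A)].
have qM := face_index_lt q.
apply/andP; split; first (apply/andP; split).
- by apply/forallP => A; rewrite ffunE face_le_mkl.
- apply/forallP => r; apply/implyP => /face_le_mkface[rq rE].
  apply/existsP; exists (e @^-1: face_set r); rewrite ffunE.
  suff -> : e @: (e @^-1: face_set r) = face_set r by rewrite -rE.
  apply/setP => i; apply/imsetP/idP; first by move=> [a]; rewrite inE => h ->.
  move=> ir; have iq : i \in mem (face_set q) by exact: (fintype.subsetP rq).
  exists (enum_rank_in iq i); rewrite ?inE /e enum_rankK_in//.
- apply/forallP => A; apply/forallP => B; rewrite !ffunE face_le_mk//.
  apply/eqP; apply/idP/idP; first exact: imsetS.
  move=> /fintype.subsetP h; apply/fintype.subsetP => a aA.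
  have /imsetP[b bB /enum_val_inj ->//] := h _ (imset_f e aA).
Qed.

Lemma face_simplicial : @simplicial_poset face face_le face0.
Proof.
split; [exact: face_le_refl|exact: face_le_anti|exact: face_le_trans|exact: face_le0|].
by move=> q; exists #|face_set q|; rewrite boolean_rank.
Qed.

Lemma face_fcount k : @fcount face face_le k = #|[set q | #|face_set q| == k]%SET|.
Proof.
apply: eq_card => q; rewrite [RHS]finset.in_set -boolean_rank.
by apply/idP/idP => [|h]; rewrite in_setE.
Qed.

(** Expand the product of factors [x + 0] for [i] in [B] and [x + (1 - x)] for the others, with [S]
    recording where the first summand is taken. *)
Lemma sum_superset (K : comNzRingType) (x : K) (B : {set 'I_d}) :
  \sum_(S : {set 'I_d} | B \subset S) x ^+ #|S| * (1 - x) ^+ (d - #|S|) = x ^+ #|B|.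
Proof.
transitivity (\prod_(i < d) ((if i \in B then x else x) + (if i \in B then 0 else 1 - x))).
  rewrite bigA_distr big_mkcond/=; apply: eq_bigr => S _.
  case: ifPn => [BS|/subsetPn[i iB iS]]; last first.
    by rewrite (bigD1 i)//= (negPf iS) iB mul0r.
  rewrite (bigID (mem S))/=; congr (_ * _).
    under eq_bigr => i iS do rewrite iS if_same; by rewrite prodr_const.
  under eq_bigr => i iS.
    rewrite (negPf iS) ifN; last by apply: contra iS; exact: (fintype.subsetP BS).
  over.
  rewrite prodr_const; congr (_ ^+ _).
  rewrite (_ : #|_| = #|~: S|); last by apply: eq_card => i; rewrite !inE.
  by have := cardsC S; rewrite card_ord => cS; rewrite -[X in (X - _)%N]cS addKn.
rewrite (bigID (mem B))/=.
under eq_bigr => i iB do rewrite iB addr0.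
rewrite prodr_const big1 ?mulr1// => i iB.
by rewrite (negPf iB) subrKC.
Qed.

Lemma face_hpoly : @hpoly face face_le d = \sum_(k < M) 'X ^+ #|C k|.
Proof.
rewrite /hpoly.
transitivity (\sum_(q : face) 'X^#|face_set q| * (1 - 'X : {poly int}) ^+ (d - #|face_set q|)).
  rewrite (partition_big (fun q => inord #|face_set q| : 'I_d.+1) xpredT)//=.
  apply: eq_bigr => i _; rewrite face_fcount -mulrA mulr_natl -sumr_const.
  have cd q : (#|face_set q| < d.+1)%N by rewrite ltnS -[leqRHS]card_ord max_card.
  apply: eq_big => [q|q]; first by rewrite inE -val_eqE/= inordK.
  by rewrite inE => /eqP ->.
transitivity (\sum_(x : 'I_M * {set 'I_d} | C x.1 \subset x.2)
   'X^#|x.2| * (1 - 'X : {poly int}) ^+ (d - #|x.2|)).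
  rewrite (reindex_onto val (insubd face0))/=; last by move=> x h; rewrite insubdK.
  by apply: eq_big => // q; rewrite (valP q) valKd eqxx.
rewrite -(pair_big_dep xpredT (fun (k : 'I_M) (S : {set 'I_d}) => C k \subset S)
  (fun k S => 'X^#|S| * (1 - 'X : {poly int}) ^+ (d - #|S|)))/=.
by apply: eq_bigr => k _; exact: sum_superset.
Qed.

Lemma face_dim : @has_dim_dm1 face face_le d.
Proof.
split.
  rewrite face_fcount => /eqP; rewrite cards_eq0 => /eqP/setP.
  have [_ h2] := mkfaceP [set: 'I_d]%SET M0.
  by move=> /(_ (mkface 0 [set: 'I_d]%SET)); rewrite !inE h2 cardsT card_ord eqxx.
move=> k dk; rewrite face_fcount; apply/eqP; rewrite cards_eq0.
apply/eqP/setP => q; rewrite !inE; apply/negP => /eqP E; move: dk; rewrite -E ltnNge.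
by rewrite -[X in (_ <= X)%N]card_ord max_card.
Qed.
End FacePoset.

Local Notation R := Rdefinitions.R.

(** * The order complex as a union of subdivided simplices *)

Section Realization.
Local Open Scope ring_scope.
Local Open Scope classical_set_scope.
Variables (m : nat).
Let d := m.+1.
Variables (C : nat -> {set 'I_d}) (p : nat -> 'I_d -> nat)
  (rep : nat -> {set 'I_d} -> nat) (M : nat).
Hypotheses (M0 : (0 < M)%N) (sh : shelling C p rep M).
Let T : finType := face C M.
Let le : rel T := face_le rep (M := M).
Let z : T := face0 M0 sh.
Let mk k S : T := mkface M0 sh k S.
Implicit Types (y : 'rV[R]_#|T|) (q : T).

(** The barycentre of the face [S]. The map [bary] keeps the position inside a simplex and forgets
    which simplex it is; on [facet_part l] nothing is lost. *)
Definition bary_coord (S : {set 'I_d}) (i : 'I_d) : R := if i \in S then #|S|%:R^-1 else 0.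

Definition bary y : 'rV[R]_d := \row_i \sum_q bary_coord (face_set q) i * coord y q.

Let A : set 'rV[R]_#|T| := @realization T le z.
Let facet_part (l : nat) : set 'rV[R]_#|T| :=
  [set y | A y /\ forall q, q != mk l (face_set q) -> coord y q = 0].

Lemma coord_eq y y' : (forall q, coord y q = coord y' q) -> y = y'.
Proof.
by move=> h; apply/rowP => i; have := h (enum_val i); rewrite /coord enum_valK.
Qed.

Lemma sum_bary_coord (S : {set 'I_d}) : S != finset.set0 -> \sum_i bary_coord S i = 1.
Proof.
move=> S0; rewrite /bary_coord -big_mkcond/= sumr_const -[LHS]mulr_natl mulfV//.
by rewrite pnatr_eq0 cards_eq0.
Qed.

Lemma bary_coord_ge0 (S : {set 'I_d}) i : 0 <= bary_coord S i.
Proof. by rewrite /bary_coord; case: ifP => // _; rewrite invr_ge0 ler0n. Qed.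

Lemma bary_coord_gt0 (S : {set 'I_d}) i : (0 < bary_coord S i) = (i \in S).
Proof.
rewrite /bary_coord; case: ifPn => [iS|]; last by rewrite ltxx.
by rewrite invr_gt0 ltr0n card_gt0; apply/set0Pn; exists i.
Qed.

Lemma baryE y i : bary y ord0 i = \sum_q bary_coord (face_set q) i * coord y q.
Proof. by rewrite mxE. Qed.

Lemma bary_simplex y : A y -> simplex (bary y).
Proof.
move=> [y0 [y1 [yz _]]]; split => [i|].
  by rewrite baryE sumr_ge0// => q _; rewrite mulr_ge0// bary_coord_ge0.
under eq_bigr do rewrite baryE.
rewrite exchange_big/= -[RHS]y1; apply: eq_bigr => q _; rewrite -mulr_suml.
have [->|qz] := eqVneq q z; first by rewrite yz mulr0.
by rewrite sum_bary_coord ?mul1r// (face_set_eq0 M0 sh).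
Qed.

Lemma supp_bary y i : A y -> (i \in supp (bary y)) = [exists q, (0 < coord y q) && (i \in face_set q)].
Proof.
move=> Ay; have y0 := Ay.1; rewrite inE baryE; apply/idP/existsP.
  move=> h; apply: contrapT => nex; move: h; rewrite big1 ?ltxx// => q _.
  have [iq|iq] := boolP (i \in face_set q); last by rewrite /bary_coord (negPf iq) mul0r.
  have [->|q0] := eqVneq (coord y q) 0; first by rewrite mulr0.
  by exfalso; apply: nex; exists q; rewrite iq andbT lt_neqAle eq_sym q0 y0.
move=> [q /andP[q0 iq]]; rewrite (bigD1 q)//=; apply: ltr_pwDl.
  by rewrite mulr_gt0// bary_coord_gt0.
by apply: sumr_ge0 => r _; rewrite mulr_ge0// bary_coord_ge0.
Qed.

(** The largest face of the chain carries the whole chain into one simplex and is visible from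
    [bary y] through its support. *)
Lemma chain_top y : A y -> exists q,
  [/\ 0 < coord y q, supp (bary y) = face_set q & forall r, 0 < coord y r -> le r q].
Proof.
move=> Ay; have [y0 [y1 [yz yc]]] := Ay.
have [q0 q00] : exists q, 0 < coord y q.
  apply: contrapT => nex; move: y1; rewrite big1.
    by move/eqP; rewrite eq_sym oner_eq0.
  move=> q _; apply/eqP; rewrite eq_le y0 andbT leNgt; apply/negP => h; apply: nex; by exists q.
pose q := [arg max_(q > q0 | 0 < coord y q) #|face_set q|].
have [qp qm] : 0 < coord y q /\ forall r, 0 < coord y r -> (#|face_set r| <= #|face_set q|)%N.
  by rewrite /q; case: arg_maxnP.
have top r : 0 < coord y r -> le r q.
  move=> rp; have /orP[//|/andP[h /eqP e]] := yc _ _ rp qp.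
  have E : face_set q = face_set r by apply/eqP; rewrite eqEcard h qm.
  have -> : q = r by apply: face_eq => //; rewrite -e E (rep_face_index sh).
  exact: (face_le_refl sh).
exists q; split => //; apply/setP => i; rewrite supp_bary//; apply/existsP/idP.
  by move=> [r /andP[/top/andP[h _] ir]]; exact: (fintype.subsetP h).
by move=> iq; exists q; rewrite qp.
Qed.

Lemma facet_part_rep y l q : (l < M)%N -> facet_part l y -> 0 < coord y q -> rep l (face_set q) = face_index q.
Proof.
move=> lM [Ay h] qp; have := h q; have [-> _ |_ /(_ isT) h0] := eqVneq q (mk l (face_set q)).
  by have [-> ->] := mkfaceP M0 sh (face_set q) lM.
by rewrite h0 ltxx in qp.
Qed.

Lemma facet_part_exists y : A y -> exists2 l, (l < M)%N & facet_part l y.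
Proof.
move=> Ay; have [q [qp _ top]] := chain_top Ay; exists (face_index q); first exact: face_index_lt.
split => // r rn; apply/eqP; rewrite eq_le Ay.1 andbT leNgt; apply/negP => rp.
by move/eqP: rn; apply; have /(face_le_mkface M0 sh)[] := top _ rp.
Qed.

Lemma rep_supp_bary y k l : (k < M)%N -> (l < M)%N -> facet_part k y -> facet_part l y ->
  rep k (supp (bary y)) = rep l (supp (bary y)).
Proof.
move=> kM lM Ak Al'; have [q [qp -> _]] := chain_top Ak.1.
by rewrite (facet_part_rep kM Ak qp) (facet_part_rep lM Al' qp).
Qed.

(** On simplex [l] the faces are indexed by their vertex sets, so [bary] becomes the sum over a
    chain weight, and the decomposition lemmas give its injectivity and surjectivity. *)
Lemma bary_Al y l i : (l < M)%N -> facet_part l y ->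
  bary y ord0 i = \sum_(S : {set 'I_d} | i \in S) coord y (mk l S) / #|S|%:R.
Proof.
move=> lM [Ay h]; rewrite baryE (bigID (fun q => q == mk l (face_set q)))/= addrC big1 ?add0r; last first.
  by move=> q /h ->; rewrite mulr0.
have fmk S : face_set (mk l S) = S by have [_ ->] := mkfaceP M0 sh S lM.
rewrite (reindex_onto (mk l) (@face_set d C M))/=; last by move=> q /eqP <-.
rewrite [RHS]big_mkcond/=; apply: eq_big => S; first by rewrite fmk !eqxx.
by move=> _; rewrite fmk /bary_coord; case: ifP => _; rewrite ?mul0r// mulrC.
Qed.

Lemma facet_part_chain_weight y l : (l < M)%N -> facet_part l y ->
  chain_weight (fun S : {set 'I_d} => coord y (mk l S) / #|S|%:R).
Proof.
move=> lM [[y0 [y1 [yz yc]]] h]; split => [S||S S'].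
- by rewrite divr_ge0// ler0n.
- have -> : mk l finset.set0 = z by apply/eqP; rewrite -(face_set_eq0 M0 sh); have [_ ->] := mkfaceP M0 sh finset.set0 lM.
  by rewrite yz mul0r.
- have pos (S1 : {set 'I_d}) : 0 < coord y (mk l S1) / #|S1|%:R -> 0 < coord y (mk l S1).
    move=> h1; rewrite lt_neqAle y0 andbT eq_sym; apply: contraTneq h1 => ->.
    by rewrite mul0r ltxx.
  move=> /pos h1 /pos h2; have := yc _ _ h1 h2.
  by rewrite /le !(face_le_mk M0 sh).
Qed.

Lemma facet_part_inj y y' l : (l < M)%N -> facet_part l y -> facet_part l y' -> bary y = bary y' -> y = y'.
Proof.
move=> lM Ay Ay' E; apply: coord_eq => q.
have [qE|qn] := eqVneq q (mk l (face_set q)); last by rewrite (Ay.2 q)// (Ay'.2 q).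
have gE := chain_weight_inj (facet_part_chain_weight lM Ay) (facet_part_chain_weight lM Ay').
have /gE/(_ (face_set q)) : forall i, \sum_(S : {set 'I_d} | i \in S) coord y (mk l S) / #|S|%:R =
    \sum_(S : {set 'I_d} | i \in S) coord y' (mk l S) / #|S|%:R.
  by move=> i; rewrite -!bary_Al// E.
rewrite -qE; have [->|qz] := eqVneq q z.
  by rewrite Ay.1.2.2.1 Ay'.1.2.2.1.
by apply: mulIf; rewrite invr_eq0 pnatr_eq0 cards_eq0 (face_set_eq0 M0 sh).
Qed.

Lemma facet_part_onto l (x : 'rV[R]_d) : (l < M)%N -> simplex x -> exists2 y, facet_part l y & bary y = x.
Proof.
move=> lM Dx; have [g [cg gs gx]] := chain_weight_exists Dx.1.
have fmk S : face_set (mk l S) = S by have [_ ->] := mkfaceP M0 sh S lM.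
pose w q : R := if q == mk l (face_set q) then g (face_set q) * #|face_set q|%:R else 0.
pose y : 'rV[R]_#|T| := \row_j w (enum_val j).
have yE q : coord y q = w q by rewrite /coord mxE enum_rankK.
have ymk S : coord y (mk l S) = g S * #|S|%:R by rewrite yE /w fmk eqxx.
have gdiv S : coord y (mk l S) / #|S|%:R = g S.
  rewrite ymk; have [->|S0] := eqVneq S finset.set0; first by rewrite (chain_set0 cg) !mul0r.
  by rewrite mulfK// pnatr_eq0 cards_eq0.
have w0 q : 0 <= w q by rewrite /w; case: ifP => // _; rewrite mulr_ge0 ?ler0n//; exact: (chain_ge0 cg).
have wpos q : 0 < w q -> q = mk l (face_set q) /\ 0 < g (face_set q).
  rewrite /w; case: eqP => [-> h|]; last by rewrite ltxx.
  rewrite !fmk in h *; split => //; rewrite lt_neqAle (chain_ge0 cg) andbT eq_sym.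
  by apply: contraTneq h => ->; rewrite mul0r ltxx.
have Ay : facet_part l y.
  split; last by move=> q qn; rewrite yE /w (negPf qn).
  split; first by move=> q; rewrite yE.
  split.
    rewrite (bigID (fun q => q == mk l (face_set q)))/= addrC big1 ?add0r; last first.
      by move=> q qn; rewrite yE /w (negPf qn).
    rewrite (reindex_onto (mk l) (@face_set d C M))/=; last by move=> q /eqP <-.
    transitivity (\sum_(S : {set 'I_d}) \sum_(i in S) g S).
      apply: eq_big => S; first by rewrite fmk !eqxx.
      by move=> _; rewrite ymk sumr_const mulr_natr.
    rewrite (exchange_big_dep xpredT)//= -[RHS]Dx.2.
    by apply: eq_bigr => i _; rewrite gx.
  split.
    rewrite yE /w; case: ifP => // _.
    have /eqP -> : face_set z == finset.set0 by rewrite (face_set_eq0 M0 sh).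
    by rewrite cards0 mulr0.
  move=> q r; rewrite !yE => /wpos[qE gq] /wpos[rE gr].
  have leE q1 q2 : q1 = mk l (face_set q1) -> q2 = mk l (face_set q2) ->
      le q1 q2 = (face_set q1 \subset face_set q2).
    by move=> -> ->; rewrite /le (face_le_mk M0 sh)// !fmk.
  by rewrite !leE//; exact: (chain_total cg).
exists y => //; apply/rowP => i; rewrite (bary_Al _ lM Ay) -gx.
by apply: eq_bigr => S _; rewrite gdiv.
Qed.

Lemma weighted_sum_continuous (b : T -> R) : continuous (fun y => \sum_q b q * coord y q).
Proof.
rewrite (_ : (fun y => _) = (fun y : 'rV[R]_#|T| => \sum_j b (enum_val j) * y ord0 j)).
  exact: sum_coord_continuous.
apply/funext => y; rewrite (reindex (@enum_val T T))/=.
  by apply: eq_bigr => j _; rewrite /coord enum_valK.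
by exists enum_rank => ? _; rewrite ?enum_valK ?enum_rankK.
Qed.

Lemma bary_continuous : continuous bary.
Proof.
move=> y; apply: (@cvg_rV R d _ (nbhs y)) => i.
rewrite baryE (_ : (fun y => bary y ord0 i) = (fun y => \sum_q bary_coord (face_set q) i * coord y q)).
  exact: (weighted_sum_continuous (b := fun q => bary_coord (face_set q) i)).
by apply/funext => y'; rewrite baryE.
Qed.

Lemma facet_part_compact l : (l < M)%N -> compact (facet_part l).
Proof.
move=> lM; apply: (@compact_rV_bounded_closed R _ _ 1); last first.
  move=> y [[y0 [y1 _]] _] j; have := y0 (enum_val j); rewrite /coord enum_valK => h.
  rewrite ger0_norm//; rewrite -y1 (bigD1 (enum_val j))//= {1}/coord enum_valK lerDl.
  exact: sumr_ge0.
(* The chain condition becomes closed when stated for incomparable pairs: the smaller of the two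
   coordinates is at most 0. *)
have -> : facet_part l = (\bigcap_(q in [set: T]) [set y | 0 <= coord y q]) `&`
  [set y | \sum_q 1 * coord y q = 1] `&` [set y | coord y z = 0] `&`
  \bigcap_(q in [set q : T | q != mk l (face_set q)]) [set y | coord y q = 0] `&`
  \bigcap_(qr in [set qr : T * T | ~~ (le qr.1 qr.2 || le qr.2 qr.1)])
    [set y | Num.min (coord y qr.1) (coord y qr.2) <= 0].
  have sE y : \sum_q 1 * coord y q = \sum_q coord y q by apply: eq_bigr => q _; rewrite mul1r.
  apply/seteqP; split => y.
    move=> [[y0 [y1 [yz yc]]] h]; split; first (split; [split; [split; [by move=> q _; exact: y0|by rewrite /= sE]|by []]|by []]).
    move=> [q r] /= nqr; rewrite leNgt lt_min; apply/negP => /andP[qp rp].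
    by move: nqr; rewrite yc.
  move=> [[[[y0 /= y1] yz] h] yc]; split; last by move=> q qn; exact: h.
  split; first by move=> q; exact: (y0 q I).
  rewrite -sE; do 2 (split => //).
  move=> q r qp rp; apply/negPn/negP => nqr; have := yc (q, r) nqr.
  by rewrite /= leNgt lt_min qp rp.
have cc q : continuous (fun y => coord y q : R) by exact: coord_continuous.
repeat apply: closedI.
- apply: closed_bigI => q _.
  by apply: (closed_comp (f := fun y => coord y q : R)) (@closed_ge R 0) => y _; exact: cc.
- apply: (closed_comp (f := fun y => \sum_q 1 * coord y q : R)) (@closed_eq R 1) => y _.
  exact: (weighted_sum_continuous (b := fun=> 1)).
- by apply: (closed_comp (f := fun y => coord y z : R)) (@closed_eq R 0) => y _; exact: cc.
- apply: closed_bigI => q _.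
  by apply: (closed_comp (f := fun y => coord y q : R)) (@closed_eq R 0) => y _; exact: cc.
- apply: closed_bigI => qr _.
  apply: (closed_comp (f := fun y => Num.min (coord y qr.1) (coord y qr.2) : R)) (@closed_le R 0) => y _.
  by apply: continuous_min; exact: cc.
Qed.

Lemma realization_ball : is_ball m A.
Proof.
have [Phi bp] := @ball_param_exists R m C p rep M sh M0.
have clE : closed_ball (0 : 'rV[R]_m) 1 = [set u | `|u| <= 1].
  by rewrite closed_ballE//; apply/seteqP; split => u; rewrite /closed_ball_/= sub0r normrN.
pose idx y : nat := xget 0%N [set l | (l < M)%N /\ facet_part l y].
have idxP y : A y -> (idx y < M)%N /\ facet_part (idx y) y.
  move=> /facet_part_exists[l lM Aly]; rewrite /idx; case: xgetP => [k _ //|/(_ l)]; by case.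
(* The simplex chosen by [idx] does not matter: by [rep_supp_bary] and [ball_inj], every simplex
   containing [y] gives the same value. *)
pose f y := Phi (idx y) (bary y).
have fE y l : (l < M)%N -> facet_part l y -> f y = Phi l (bary y).
  move=> lM Aly; have [iM Ai] := idxP _ Aly.1.
  apply/(ball_inj bp) => //; [exact: bary_simplex Aly.1|exact: bary_simplex Aly.1|].
  by split => //; exact: rep_supp_bary.
have fK y : A y -> `|f y| <= 1.
  by move=> Ay; have [iM _] := idxP _ Ay; apply: (ball_norm bp) => //; exact: bary_simplex.
have finj y y' : A y -> A y' -> f y = f y' -> y = y'.
  move=> Ay Ay'; have [iM Ai] := idxP _ Ay; have [iM' Ai'] := idxP _ Ay'.
  move=> /(ball_inj bp iM iM' (bary_simplex Ay) (bary_simplex Ay'))[bE rE].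
  have [q [qp qs top]] := chain_top Ay; have [q' [qp' qs' top']] := chain_top Ay'.
  (* The top faces of both chains have the same vertex set and first simplex, so both points lie in
     one facet part, where [bary] is injective. *)
  have qq' : q = q'.
    apply: face_eq; last by rewrite -qs -qs' bE.
    by rewrite -(facet_part_rep iM Ai qp) -(facet_part_rep iM' Ai' qp') -qs rE -qs' bE.
  have inAl y1 : A y1 -> (forall r, 0 < coord y1 r -> le r q) -> facet_part (face_index q) y1.
    move=> Ay1 top1; split => // r rn; apply/eqP; rewrite eq_le Ay1.1 andbT leNgt; apply/negP => rp.
    by move/eqP: rn; apply; have /(face_le_mkface M0 sh)[] := top1 _ rp.
  have Aly : facet_part (face_index q) y by exact: inAl.
  have Aly' : facet_part (face_index q) y' by apply: inAl => //; rewrite qq'.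
  exact: (facet_part_inj (face_index_lt q) Aly Aly' bE).
have fonto u : `|u| <= 1 -> exists2 y, A y & f y = u.
  move=> /(ball_onto bp)[l [x [lM Dx <-]]]; have [y Aly <-] := facet_part_onto lM Dx.
  by exists y; [exact: Aly.1|exact: fE].
have cAl (i : 'I_M) : compact (facet_part i) by exact: facet_part_compact.
have cf : {within A, continuous f}.
  apply: (@within_continuous_quotient R _ _ _ 'I_M (fun l => facet_part l) (fun _ => id)) => //.
  - by move=> l; apply: continuous_subspaceT => y; exact: cvg_id.
  - move=> l; apply: (@subspace_eq_continuous _ _ _ (Phi l \o bary)).
      by move=> y; rewrite inE => Aly; symmetry; exact: fE.
    apply: (@comp_within_continuous _ _ _ _ _ (simplex (d := d))).
    + by move=> y [Ay _]; exact: bary_simplex.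
    + by apply: continuous_subspaceT; exact: bary_continuous.
    + exact: (ball_continuous bp).
  - by move=> y /facet_part_exists[l lM Aly]; exists (Ordinal lM), y.
pose g u : 'rV[R]_#|T| := xget 0 [set y | A y /\ f y = u].
have gP u : `|u| <= 1 -> A (g u) /\ f (g u) = u.
  by move=> /fonto[y Ay fy]; rewrite /g; case: xgetP => [y' _ //|/(_ y)[]].
have gK y : A y -> g (f y) = y.
  move=> Ay; have [h1 h2] := gP _ (fK _ Ay); exact: finj.
exists f, g; rewrite clE; split; first by move=> y /fK.
split; first by move=> u /gP[].
split; first exact: gK.
split; first by move=> u /gP[].
split => //.
(* The inverse is continuous because the compact parts map onto the ball and [g \o f] is the
   identity on each. *)
apply: (@within_continuous_quotient R _ _ _ 'I_M (fun l => facet_part l) (fun _ => f)) => //.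
- by move=> l; apply: continuous_subspaceW cf => y [].
- move=> l; apply: (@subspace_eq_continuous 'rV[R]_#|T| (facet_part l) 'rV[R]_#|T| (fun y => y) (g \o f)).
    by move=> y; rewrite inE => -[Ay _]; symmetry; exact: gK.
  by apply: continuous_subspaceT => y; exact: cvg_id.
- move=> u /gP[Ag fg]; have [l lM Alg] := facet_part_exists Ag.
  by exists (Ordinal lM), (g u).
Qed.
End Realization.

Lemma realizable_of_shelling d (C : nat -> {set 'I_d}) p rep M (h : seq nat) :
  (0 < d)%N -> (0 < M)%N -> shelling C p rep M ->
  (\sum_(k < M) 'X^#|C k| = \sum_(i < d.+1) 'X^i *+ nth 0%N h i :> {poly int})%R ->
  realizable_ball d h.
Proof.
case: d C p rep => // m C p rep _ M0 sh E.
exists (face C M), (face_le rep (M := M)), (face0 M0 sh); split.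
- exact: (face_simplicial M0 sh).
- exact: realization_ball.
- split; first exact: (face_dim M0 sh).
  move=> i im; rewrite (face_hpoly M0 sh) E coef_sum.
  rewrite (bigD1 (Ordinal (im : (i < m.+2)%N)))//= big1.
    by rewrite coefMn coefXn eqxx addr0 natz.
  move=> j ji; rewrite coefMn coefXn; case: eqP => [e|]; last by rewrite mul0rn.
  by move/eqP: ji; case; apply: val_inj.
Qed.

Unset Implicit Arguments.
Local Open Scope ring_scope.

Theorem theorem6p2 (d : nat) (h : seq nat) :
  size h = d.+1 -> nth 0%N h 0 = 1%N -> nth 0%N h d = 0%N ->
  ((forall j, (j <= (d.-1)./2)%N -> 0 < dh d h j) -> realizable_ball d h) /\
  (forall n : nat,
     (forall j, (j <= (d.-1)./2)%N -> 0 <= dh d h j) ->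
     (0 < n)%N -> (n <= (d.-1)./2)%N -> dh d h n = 0 ->
     (forall j, (j < n)%N -> dh d h j != 0) ->
     ~~ odd (\sum_(i <- h) i) ->
     (forall l, (n.+1 <= l)%N -> (l <= d - n.+1)%N ->
        dh d h l <= (\sum_(0 <= i < n) nth 0%N h (l - i))%:Z) ->
     realizable_ball d h).
Proof.
move=> sz h0 hd.
have d0 : (0 < d)%N by rewrite lt0n; apply/eqP => d0; move: hd; rewrite d0 h0.
split=> [dh_gt0|n dh_ge0 n0 nd dhn dh_neq0 ev U].
  (* The entry at 0 is dropped; it belongs to the first simplex. *)
  pose c i := if i == 0%N then 0%N else nth 0%N h i.
  have hc i : nth 0%N h i = ((i == 0%N) + c i)%N by rewrite /c; case: eqP => [->|].
  have [s [ss sb cnt sumE]] := sorted_multiset c d.+1.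
  have bnd x : x \in s -> (0 < x < d)%N.
    move=> /sb[xd]; rewrite /c; case: eqP => // x0 hx.
    have : x <> d by move=> xE; rewrite xE hd in hx.
    lia.
  have pair_le : forall i, (i < (size s)./2)%N -> (nth 0 s i + nth 0 s ((size s).-1 - i) <= d)%N.
    apply: sorted_pair_le => // l ld; rewrite !cnt sum_high ?sum_low; [|lia|lia].
    have := dh_gt0 l ld; rewrite dhE.
    have -> : (\sum_(i < l.+1) nth 0 h i = 1 + \sum_(i < l.+1) c i)%N.
      by under eq_bigr do rewrite hc; rewrite big_split/= sum_indicator.
    have -> : (\sum_(i < l.+1) nth 0 h (d - i) = \sum_(i < l.+1) c (d - i))%N.
      by apply: eq_bigr => i _; rewrite /c ifN//; have := ltn_ord i; lia.
    lia.
  have [C [p [rep [M [M0 sh hE]]]]] := sorted_pairs_shelling ss bnd pair_le d0.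
  apply: (realizable_of_shelling d0 M0 sh); rewrite hE sumE; symmetry.
  under eq_bigr do rewrite hc mulrnDr.
  rewrite big_split/=; congr (_ + _).
  by rewrite big_ord_recl/= expr0 mulr1n big1 ?addr0.
have nd' : (n < d - n)%N by lia.
(* Since [dh] is positive at [n.-1] and 0 at [n], the entry of [h] at [d - n] exceeds the one at [n]
   by that positive amount. *)
have hdn : (0 < nth 0%N h (d - n))%N.
  have n1 : (n.-1 <= d.-1./2)%N by lia.
  have := dh_ge0 _ n1; have := dh_neq0 n.-1; rewrite prednK// leqnn => /(_ isT).
  move: dhn; rewrite !dhE prednK// !big_ord_recr/=; lia.
(* Besides the entry at 0, one copy of [d - n] is set aside for the last simplex. *)
pose c i := if i == 0%N then 0%N else (nth 0%N h i - (i == d - n)%N)%N.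
have hc i : nth 0%N h i = ((i == 0%N) + c i + (i == d - n)%N)%N.
  rewrite /c; case: eqP => [->|i0]; first by rewrite h0; have /negPf -> : (0 != d - n)%N by lia.
  by rewrite add0n subnK//; case: eqP => // ->.
have [s [ss sb cnt sumE]] := sorted_multiset c d.+1.
have bnd x : x \in s -> (0 < x < d)%N.
  move=> /sb[xd]; rewrite /c; case: eqP => // x0 hx.
  have : x <> d by move=> xE; rewrite xE hd in hx.
  lia.
have low l : (l < d - n)%N -> (\sum_(i < l.+1) nth 0 h i = 1 + count (fun x => x <= l) s)%N.
  move=> ld; rewrite cnt sum_low; last by lia.
  under eq_bigr do rewrite hc.
  rewrite !big_split/= !sum_indicator.
  have -> : (d - n < l.+1)%N = false by lia.
  by rewrite addn0.
have high l : (l < d)%N ->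
    (\sum_(i < l.+1) nth 0 h (d - i) = count (fun x => d - l <= x) s + (n <= l))%N.
  move=> ld; rewrite cnt sum_high; last by lia.
  rewrite -ltnS -(sum_indicator l.+1 n) -big_split/=; apply: eq_bigr => i _.
  rewrite hc; have il := ltn_ord i.
  have -> : (d - i == 0)%N = false by lia.
  by rewrite add0n; congr (_ + nat_of_bool _)%N; lia.
have total : (\sum_(i <- h) i = 2 + size s)%N.
  rewrite (big_nth 0%N) sz big_mkord; under eq_bigr do rewrite hc.
  rewrite !big_split/= !sum_indicator -(count_predT s) cnt /=.
  have -> : (d - n < d.+1)%N by lia.
  lia.
have qe : ~~ odd (size s) by move: ev; rewrite total oddD.
have nb : (0 < n < d)%N by lia.
have pair_le : forall i, (i < (size s)./2)%N -> (nth 0 s i + nth 0 s ((size s).-1 - i) <= d)%N.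
  apply: sorted_pair_le => // l ld.
  have := dh_ge0 l ld; rewrite dhE low ?high; [|lia|lia].
  (* For [l >= n] the copy of [d - n] set aside balances the missing entry at 0; for [l < n] that
     copy is not counted, and [dh d h l != 0] supplies the unit instead. *)
  have [ln|nl] := ltnP l n; last by lia.
  have := dh_neq0 l ln; rewrite dhE low ?high; [|lia|lia].
  by rewrite leqNgt ln /=; lia.
have pair_ge : forall i, (i < (size s)./2)%N ->
    (d - n <= nth 0 s i + nth 0 s ((size s).-1 - i))%N.
  apply: sorted_pair_ge => // [l /andP[nl ld]|].
    have /U : (n < l)%N by [].
    rewrite dhE low// high; last by lia.
    have := sum_window (nth 0%N h) (ltnW nl); rewrite low// low; last by lia.
    by rewrite (ltnW nl); lia.
  (* Vanishing of [dh] at [n] says that as many sizes are [<= n] as are [>= d - n]. These ranges are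
     disjoint, so each holds at most half of the sizes. *)
  have := dhn; rewrite dhE low// high; last by lia.
  rewrite leqnn => e.
  have : (count (fun x => d - n <= x)%N s <= count (predC (fun x => x <= n)%N) s)%N.
    by apply: sub_count => x /=; lia.
  by have := count_predC (fun x => x <= n)%N s; lia.
have [C [p [rep [M [M0 sh hE]]]]] :=
  sorted_pairs_closing_shelling ss bnd pair_le qe nb pair_ge.
apply: (realizable_of_shelling d0 M0 sh); rewrite hE sumE; symmetry.
under eq_bigr do rewrite hc !mulrnDr.
rewrite !big_split/=; congr (_ + _ + _).
  by rewrite big_ord_recl/= expr0 mulr1n big1 ?addr0.
have dn : (d - n < d.+1)%N by lia.
rewrite (bigD1 (Ordinal dn))//= eqxx mulr1n big1 ?addr0// => i ni.
by case: eqP => // e; move/eqP: ni; case; apply: val_inj.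
Qed.
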